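(* Let $\alpha\in(0,1)$ and consider the de Finetti model, with all $\kappa_l$ real. For $x\in\{0,\ldots,q-1\}^d$ of type $m$ define $$g_x=\frac{1}{q^{d/2}}\Bigg\{\sum_{l:|l|\le d}\sqrt{\frac{h_l}{1+\frac{\alpha}{1-\alpha}(1-\kappa_l)}}\;Q_l(m;(\theta_k))\,\gamma_l\Bigg\},$$ where $(\gamma_l)$ are i.i.d. standard Gaussian random variables. Then $(g_x)$ is a complex mean zero Gaussian field such that, for $x,y$ of types $m,n$ respectively, $$\mathrm{Cov}(g_x,g_y)=\mathbb{E}[g_x\overline{g_y}]=\frac{1}{q^d}\Bigg\{\sum_{l:|l|\le d}\frac{h_l}{1+\frac{\alpha}{1-\alpha}(1-\kappa_l)}\,Q_l(m;(\theta_k))\,\overline{Q_l(n;(\theta_k))}\Bigg\},$$ and moreover $$g_x=\frac{1}{q^{d/2}}\Bigg\{\sum_{l:|l|\le d}\mathbb{E}\Big[\prod_{k=1}^{q-1}Y_{1/2}[k]^{l[k]}\Big]\sqrt{h_l}\,Q_l(m;(\theta_k))\,\gamma_l\Bigg\},$$ where the term of the last sum with $l=l_0=(0,\ldots,0)$ is $\gamma_{l_0}$, and $Y_{1/2}[1],\ldots,Y_{1/2}[q-1]$ are products of points in a $(q-1)$-dimensional point process with joint probability generating functional $$G_{1/2}[f_1,\ldots,f_{q-1}]=\mathbb{E}\Big[\prod_{b=1}^{T_{\alpha,1/2}}\prod_{k=1}^{q-1}f_k(\xi_b[k])\Big]=\frac{1}{\Big(1+\frac{\alpha}{1-\alpha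}\int\big(1-\prod_{k=1}^{q-1}f_k(\xi[k])\big)\nu(d\xi)\Big)^{1/2}}.$$
   Context: Let $q\ge2$, $d\ge1$ be integers, $\theta_k=e^{2\pi ik/q}$. The type of $x\in\{0,\ldots,q-1\}^d$ is $m=(m[0],\ldots,m[q-1])$, $m[j]=|\{k:x[k]=j\}|$. Indices $l=(l[1],\ldots,l[q-1])$ are vectors of nonnegative integers, $|l|=\sum_kl[k]$. $Q_l(m;(\theta_k))$ is the coefficient of $w_1^{l[1]}\cdots w_{q-1}^{l[q-1]}$ in $\prod_{j=0}^{q-1}\big(1+\sum_{k=1}^{q-1}w_k\theta_k^j\big)^{m[j]}$, and $h_l^{-1}=\frac{d!}{(d-|l|)!\,l[1]!\cdots l[q-1]!}$. De Finetti model: $\mu$ is a probability measure on the set of probability distributions $p=(p[0],\ldots,p[q-1])$ on $\{0,\ldots,q-1\}$; the increment $V$ of the random walk has $d$ entries which, conditionally on $p\sim\mu$, are i.i.d. with distribution $p$. Put $\xi[k]=\sum_{j=0}^{q-1}\theta_1^{kj}p[j]$, let $\nu$ be the law of $\xi$ when $p\sim\mu$, and $\kappa_l=\int\prod_{k=1}^{q-1}\xi[k]^{l[k]}\nu(d\xi)$. Point process: $(\xi_b)_{b\ge1}$ are i.i.d. with law $\nu$, independent of $T_{\alpha,1/2}$, which is negative binomial with $\mathbb{P}(T_{\alpha,1/2}=t)=(1-\alpha)^{1/2}\alpha^t\,\frac{\phi(\phi+1)\cdots(\phi+t-1)}{t!}$, $\phi=\tfrac12$, $t=0,1,2,\ldots$;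 the products of points are $Y_{1/2}[k]=\prod_{b=1}^{T_{\alpha,1/2}}\xi_b[k]$ (empty product $1$). The $f_k$ are measurable functions from the closed complex unit disc to itself, and the square root is principal. *)

(* Defs.v *)
From HB Require Import structures.
From mathcomp Require Import all_boot all_order all_algebra.
From mathcomp Require Import all_classical all_reals all_analysis.
From mathcomp Require Import complex.
(* The notations of mpoly clash with those of MathComp-Analysis. *)
From mathcomp Require Import -(notations) mpoly.

Set Implicit Arguments.
Unset Strict Implicit.
Unset Printing Implicit Defensive.

Import Order.TTheory GRing.Theory Num.Theory.
Import numFieldNormedType.Exports.

Local Open Scope classical_set_scope.
Local Open Scope ring_scope.

Definition complex_display : measure_display -> measure_display.
Proof. exact. Qed.

Section complex_measurable.
Variable R : realType.

HB.instance Definition _ := isPointed.Build R[i] 0.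

(* The sigma-algebra generated by the real and imaginary parts, which is the
   Borel sigma-algebra of the complex plane. *)
Let complex_measurable : set (set R[i]) :=
  g_sigma_preimageU (@complex.Re R) (@complex.Im R).

Let complex_measurable0 : complex_measurable set0.
Proof. exact: sigma_algebra0. Qed.

Let complex_measurableC A : complex_measurable A -> complex_measurable (~` A).
Proof. exact: sigma_algebraC. Qed.

Let complex_measurable_bigcup (F : (set R[i])^nat) :
  (forall i, complex_measurable (F i)) ->
  complex_measurable (\bigcup_i (F i)).
Proof. exact: sigma_algebra_bigcup. Qed.

HB.instance Definition _ := @isMeasurable.Build
  (complex_display default_measure_display)
  R[i] complex_measurable complex_measurable0 complex_measurableC
  complex_measurable_bigcup.

Lemma measurable_Re : measurable_fun [set: R[i]] (@complex.Re R).
Proof.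
by move=> _ A mA; rewrite setTI; apply: sub_sigma_algebra; left; exists A;
  rewrite ?setTI.
Qed.

Lemma measurable_Im : measurable_fun [set: R[i]] (@complex.Im R).
Proof.
by move=> _ A mA; rewrite setTI; apply: sub_sigma_algebra; right; exists A;
  rewrite ?setTI.
Qed.

Lemma measurable_fun_complexP d (T : measurableType d) (f : T -> R[i]) :
  measurable_fun [set: T] (fun t => complex.Re (f t)) ->
  measurable_fun [set: T] (fun t => complex.Im (f t)) ->
  measurable_fun [set: T] f.
Proof.
move=> mre mim.
apply: (@measurability _ _ _ _ _ _
  (preimage_set_system setT (@complex.Re R) measurable `|`
   preimage_set_system setT (@complex.Im R) measurable)) => //.
move=> _ [_ [[A mA <-]|[A mA <-]] <-]; rewrite !setTI.
- by have := mre measurableT A mA; rewrite setTI.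
- by have := mim measurableT A mA; rewrite setTI.
Qed.

End complex_measurable.

Section complex_integral.
Context d (T : measurableType d) (R : realType).

Definition cintegral (mu : {measure set T -> \bar R}) (f : T -> R[i]) : R[i] :=
  Complex (\int[mu]_t complex.Re (f t)) (\int[mu]_t complex.Im (f t)).

Definition cexpectation (P : probability T R) (X : T -> R[i]) : R[i] :=
  cintegral P X.

Definition ccovariance (P : probability T R) (X Y : T -> R[i]) : R[i] :=
  cexpectation P (fun t => (X t - cexpectation P X) *
                           ((Y t - cexpectation P Y)^*)%C).

End complex_integral.

Section probability_notions.
Context d (W : measurableType d) (R : realType) (P : probability W R).

Definition mutually_independent (I : eqType) (F : I -> set (set W)) : Prop :=
  forall (J : seq I) (A : I -> set W),
    uniq J -> (forall i, i \in J -> F i (A i)) ->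
    (P (\bigcap_(i in [set` J]) A i) = \prod_(i <- J) P (A i))%E.

(* [normal_prob m s] has standard deviation s but is not the point mass at m
   when s = 0, hence the case distinction. *)
Definition gaussian_variable (X : W -> R) : Prop :=
  measurable_fun setT X /\
  exists m s : R, forall A, measurable A ->
    P (X @^-1` A) = if s == 0 then \d_m A else normal_prob m s A.

(* Joint Gaussianity of all real and imaginary parts; no circular symmetry is
   required. *)
Definition complex_gaussian_field (I : Type) (g : I -> W -> R[i]) : Prop :=
  forall (n : nat) (x : 'I_n -> I) (a b : 'I_n -> R),
    gaussian_variable (fun w => \sum_(i < n)
      (a i * complex.Re (g (x i) w) + b i * complex.Im (g (x i) w))).

Definition iid_standard_gaussian (I : eqType) (gamma : I -> {RV P >-> R}) :
    Prop :=
  (forall i A, measurable A -> distribution P (gamma i) A = normal_prob 0 1 A)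
  /\ mutually_independent (fun i => g_sigma_algebra_preimage (gamma i)).

End probability_notions.

(* An index k in {1, ..., q-1} is represented by the element k - 1 of
   'I_q.-1. Vectors l are multinomials; the l with |l| <= d form the finite
   type [bmultinom q.-1 d.+1], and [mdeg l] is |l|. *)

Section krawtchouk.
Variables (R : realType) (q : nat).

(* theta k = exp (2 i pi k / q) *)
Definition theta (k : nat) : R[i] :=
  Complex (cos (2 * pi * k%:R / q%:R)) (sin (2 * pi * k%:R / q%:R)).

Definition type_of d (x : {ffun 'I_d -> 'I_q}) (j : 'I_q) : nat :=
  #|[pred k | x k == j]|.

(* Q_l(m; (theta_k)), with w_k represented by the variable of index k - 1. *)
Definition krawtchouk (m : 'I_q -> nat) (l : multinom q.-1) : R[i] :=
  mcoeff l (\prod_(j < q)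
    (1 + \sum_(k < q.-1) theta k.+1 ^+ j *: mpolyX R[i] (mnm1 k)) ^+ m j).

Definition h d (l : multinom q.-1) : R :=
  (d`!%:R / ((d - mdeg l)`!%:R * \prod_(k < q.-1) (l k)`!%:R))^-1.

End krawtchouk.

Section de_finetti.
Variables (R : realType) (q : nat).

(* A probability measure on the set of probability distributions on
   {0, ..., q-1} is a probability measure mu on q-tuples with
   mu (distributions R q) = 1. *)
Definition distributions : set (q.-tuple R) :=
  [set p | (forall j, 0 <= tnth p j) /\ \sum_(j < q) tnth p j = 1].

Definition xi_of (p : q.-tuple R) : q.-1.-tuple R[i] :=
  [tuple \sum_(j < q) theta R q 1 ^+ (k.+1 * j) * ((tnth p j)%:C)%C
     | k < q.-1].

Lemma measurable_xi_of : measurable_fun [set: q.-tuple R] xi_of.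
Proof.
apply/measurable_fun_tnthP => k.
have -> : @tnth q.-1 R[i] ^~ k \o xi_of = fun p =>
    \sum_(j < q) theta R q 1 ^+ (k.+1 * j) * ((tnth p j)%:C)%C.
  by apply/funext => p /=; rewrite tnth_mktuple.
have ReE (z : R[i]) (x : R) : complex.Re (z * (x%:C)%C) = complex.Re z * x.
  by case: z => a b /=; rewrite mulr0 subr0.
have ImE (z : R[i]) (x : R) : complex.Im (z * (x%:C)%C) = complex.Im z * x.
  by case: z => a b /=; rewrite mulr0 add0r.
have ReD (y z : R[i]) : complex.Re (y + z) = complex.Re y + complex.Re z.
  by case: y; case: z.
have ImD (y z : R[i]) : complex.Im (y + z) = complex.Im y + complex.Im z.
  by case: y; case: z.
have mlin (c : 'I_q -> R) :
    measurable_fun [set: q.-tuple R] (fun p => \sum_(j < q) c j * tnth p j).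
  apply: measurable_sum => j; apply: measurable_realfun.measurable_funM => //.
  exact: measurable_tnth.
apply: measurable_fun_complexP.
- under eq_fun do rewrite (big_morph (@complex.Re R) ReD (erefl _)).
  under eq_fun do under eq_bigr do rewrite ReE.
  exact: mlin.
- under eq_fun do rewrite (big_morph (@complex.Im R) ImD (erefl _)).
  under eq_fun do under eq_bigr do rewrite ImE.
  exact: mlin.
Qed.

HB.instance Definition _ :=
  isMeasurableFun.Build _ _ _ _ xi_of measurable_xi_of.

Definition nu (mu : probability (q.-tuple R) R) :
  probability (q.-1.-tuple R[i]) R := distribution mu xi_of.

Definition kappa (mu : probability (q.-tuple R) R) (l : multinom q.-1) : R[i] :=
  cintegral (nu mu) (fun z => \prod_(k < q.-1) tnth z k ^+ l k).

End de_finetti.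
Arguments distributions : clear implicits.

Section field.
Context dW (W : measurableType dW) (R : realType).

Definition gfield q d (alpha : R) (mu : probability (q.-tuple R) R)
    (gamma : bmultinom q.-1 d.+1 -> W -> R) (x : {ffun 'I_d -> 'I_q}) (w : W) :
    R[i] :=
  (((q%:R `^ (d%:R / 2))^-1)%:C)%C *
  \sum_(l : bmultinom q.-1 d.+1)
    sqrtc ((h R d l)%:C%C /
           (1 + (alpha / (1 - alpha))%:C%C * (1 - kappa mu l)))
    * krawtchouk R (type_of x) l * (gamma l w)%:C%C.

End field.

Section point_process.
Context dO (O : measurableType dO) (R : realType) (P : probability O R).

Definition negative_binomial_pmf (alpha phi : R) (t : nat) : R :=
  (1 - alpha) `^ phi * alpha ^+ t * ((\prod_(i < t) (phi + i%:R)) / t`!%:R).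

(* The points are numbered from b = 0; the index [None] stands for T and
   [Some b] for the point b. *)
Definition is_point_process (n : nat) (alpha phi : R)
    (nu : probability (n.-tuple R[i]) R)
    (T : {RV P >-> nat}) (xi : nat -> {RV P >-> n.-tuple R[i]}) : Prop :=
  [/\ forall t, P (T @^-1` [set t]) = (negative_binomial_pmf alpha phi t)%:E,
      forall b A, measurable A -> distribution P (xi b) A = nu A &
      mutually_independent P (fun i : option nat =>
        if i is Some b then g_sigma_algebra_preimage (xi b)
        else g_sigma_algebra_preimage T)].

Definition point_product (n : nat) (T : O -> nat) (xi : nat -> O -> n.-tuple R[i])
    (k : 'I_n) (w : O) : R[i] :=
  \prod_(b < T w) tnth (xi b w) k.

End point_process.

Definition closed_disc (R : realType) : set R[i] := [set z | `|z| <= 1].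
Arguments closed_disc : clear implicits.

(* Main.v *)
Require Import Defs.
From HB Require Import structures.
From mathcomp Require Import all_boot all_order all_algebra.
From mathcomp Require Import all_classical all_reals all_analysis.
From mathcomp Require Import measurable_realfun.
From mathcomp Require Import complex ring lra.
From mathcomp Require Import -(notations) mpoly.

Set Implicit Arguments.
Unset Strict Implicit.
Unset Printing Implicit Defensive.

Import Order.TTheory GRing.Theory Num.Theory.
Import numFieldNormedType.Exports.

Local Open Scope classical_set_scope.
Local Open Scope ring_scope.

(** The field is g_x = sum_l A_l(x) gamma_l, a finite complex combination of
    independent standard normal variables. Its real and imaginary parts, and
    their real combinations, are real combinations of the gamma_l, hence
    centred Gaussian ([clincomb_gaussian], [clincomb_mean]), and the covariance
    is sum_l A_l(x) conj(A_l(y)) ([clincomb_covariance]). Since every kappa_l is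
    real and |kappa_l| <= 1, the number under the square root is positive
    ([kappa_denominator]), so A_l conj(A_l) gives back the quotient itself and
    the covariance formula follows.

    Two facts carry this first half. A real combination of the gamma_l has a
    normal law because the convolution of two centred normal densities is
    normal: after completing the square the product of the densities factors
    as in [normal_pdf_mul], and one factor integrates to 1
    ([gaussian_law_step], [lincomb_law]). The second moment of the centred
    normal law of standard deviation s is s ^ 2: integrating the convexity
    bound exp t >= 1 + t between the densities of deviations s and u s, and
    letting u tend to 1 from both sides, pins it down
    ([gaussian_second_moment]). Covariances then come from second moments by
    polarization, because sums of combinations are combinations
    ([lincomb_covariance]).

    The second half is the generating functional. Put
    F(z) = prod_k f_k(z_k) and c = int F d nu. Conditionally on T = t the
    product over the points has mean c ^ t by independence, so
    E[prod_{b < T} F(xi_b)] is the sum of the series of general term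
    (1 - alpha)^(1/2) (alpha c)^t (1/2)(3/2)...(t - 1/2) / t!
    ([point_process_pgf]). Its value is found from finite sums only: the
    coefficients convolve to 1 ([half_coef_conv]), so the square of the sum
    S is 1 / (1 - z), and they decrease, so |(1 - z) S - 1| <= |z| < 1 and
    (1 - z) S is the square root of 1 - z with positive real part, which is the
    principal one ([half_series_limit]). Taking f_k(z) = z ^ l_k identifies
    E[prod_k Y_k ^ l_k] with the inverse square root of the denominator
    ([point_product_moment]), which turns the first formula for g_x into the
    second one.

    Independence is used through one lemma on folds, [independent_fold]: the
    state of a recursion driven by some of the variables is independent of the
    other ones. It serves for the partial sums of the gamma_l and for the
    partial products of the F(xi_b). The functions f_k are arbitrary outside
    the closed disc; since nu is carried by the polydisc ([nu_polydisc]), they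
    may be replaced there by 0, even under the integral of a function that is
    not measurable ([cintegral_null_eq]). *)

(** * Real and imaginary parts, limits and square roots of complex numbers *)

Section complex_numbers.
Variable R : realType.

Lemma Re_mulc (a b : R[i]) : complex.Re (a * b) =
  complex.Re a * complex.Re b - complex.Im a * complex.Im b.
Proof. by case: a; case: b. Qed.

Lemma Im_mulc (a b : R[i]) : complex.Im (a * b) =
  complex.Re a * complex.Im b + complex.Im a * complex.Re b.
Proof. by case: a; case: b. Qed.

Lemma Re_addc (a b : R[i]) : complex.Re (a + b) = complex.Re a + complex.Re b.
Proof. by case: a; case: b. Qed.

Lemma Im_addc (a b : R[i]) : complex.Im (a + b) = complex.Im a + complex.Im b.
Proof. by case: a; case: b. Qed.

Lemma normc_Re_le (u : R[i]) (e : R) :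
  `|u| <= e%:C%C -> `|complex.Re u| <= e.
Proof. by move=> h; rewrite -lecR; exact: le_trans (normc_ge_Re _) h. Qed.

Lemma normc_Im_le (u : R[i]) (e : R) :
  `|u| <= e%:C%C -> `|complex.Im u| <= e.
Proof.
move=> h; have -> : complex.Im u = - complex.Re (u * 'i%C).
  by rewrite ReiNIm opprK.
rewrite normrN; apply: normc_Re_le; rewrite normrM.
by rewrite -[`|'i%C|]/(Num.sqrt _)%:C%C expr0n expr1n add0r sqrtr1 mulr1.
Qed.

Lemma normc_real (x : R) : 0 <= x -> `|x%:C%C| = x%:C%C.
Proof. by move=> x0; rewrite ger0_norm// ler0c. Qed.

(** Convergence of complex sequences is expressed on the real and imaginary
    parts, where the limit theorems for real integrals apply. *)
Definition ccvg (u : nat -> R[i]) (l : R[i]) : Prop :=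
  (complex.Re (u n) @[n --> \oo] --> complex.Re l) /\
  (complex.Im (u n) @[n --> \oo] --> complex.Im l).

Lemma ccvgM u v k l : ccvg u k -> ccvg v l -> ccvg (fun n => u n * v n) (k * l).
Proof.
move=> [u1 u2] [v1 v2].
split; rewrite ?Re_mulc ?Im_mulc.
  by under eq_fun do rewrite Re_mulc; apply: cvgB; apply: cvgM.
by under eq_fun do rewrite Im_mulc; apply: cvgD; apply: cvgM.
Qed.

Lemma ccvg_cst l : ccvg (fun=> l) l.
Proof. by split; exact: cvg_cst. Qed.

Lemma ccvg_unique u k l : ccvg u k -> ccvg u l -> k = l.
Proof.
move=> [u1 u2] [v1 v2]; apply/eqP; rewrite eq_complex; apply/andP; split.
  by apply/eqP; exact: (cvg_unique _ u1 v1).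
by apply/eqP; exact: (cvg_unique _ u2 v2).
Qed.

Lemma ccvg_geometric u l (K r : R) : `|r| < 1 ->
  (forall n, `|u n - l| <= (K * r ^+ n)%:C%C) -> ccvg u l.
Proof.
move=> r1 ul.
have K0 : K * r ^+ n @[n --> \oo] --> (0 : R).
  by rewrite -(mulr0 K); apply: cvgM; [exact: cvg_cst|exact: cvg_expr].
have sq (f : nat -> R) (a : R) : (forall n, `|f n - a| <= K * r ^+ n) ->
    f n @[n --> \oo] --> a.
  move=> fa; apply/cvgrPdist_le => e e0.
  move/cvgrPdist_le : K0 => /(_ _ e0); apply: filterS => n.
  by rewrite sub0r normrN distrC => h; apply: le_trans (fa n) (le_trans (ler_norm _) h).
split; apply: sq => n; have := ul n; set d := (_ - _).
  by move/normc_Re_le; rewrite /d; case: (u n); case: (l).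
by move/normc_Im_le; rewrite /d; case: (u n); case: (l).
Qed.

Lemma sqrtc_Re_ge0 (w : R[i]) : 0 <= complex.Re (sqrtc w).
Proof. by case: w => a b /=; exact: sqrtr_ge0. Qed.

(** The principal square root is the one with nonnegative real part, and the
    two roots are opposite. *)
Lemma sqrtc_unique (u w : R[i]) : u ^+ 2 = w -> 0 < complex.Re u -> u = sqrtc w.
Proof.
move=> uw u0; have /eqP : u ^+ 2 = sqrtc w ^+ 2 by rewrite sqr_sqrtc.
rewrite eqf_sqr => /orP[/eqP//|/eqP uE]; move: u0; rewrite uE.
have := sqrtc_Re_ge0 w; case: (sqrtc w) => a b /= a0; rewrite oppr_gt0 => /(le_lt_trans a0).
by rewrite ltxx.
Qed.

Lemma sqrtcZ (k : R) (w : R[i]) : 0 < k ->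
  sqrtc (k%:C%C * w) = (Num.sqrt k)%:C%C * sqrtc w.
Proof.
move=> k0; case: w => a b; rewrite [k%:C%C * _](_ : _ = (k * a +i* (k * b))%C); last first.
  by rewrite /GRing.mul /= !mul0r subr0 addr0.
rewrite /sqrtc !exprMn -mulrDr sqrtrM ?sqr_ge0// sqrtr_sqr gtr0_norm//.
rewrite -mulrDr -mulrBr -!mulrA !(sqrtrM _ (ltW k0)) mulf_eq0 gt_eqF//=.
rewrite sgrM gtr0_sg// mul1r [RHS]/GRing.mul /= !mul0r subr0 addr0.
by rewrite mulrCA.
Qed.

End complex_numbers.

(** * The binomial series of the inverse square root *)

Section half_binomial_series.
Variable R : realType.

(** The coefficient of z ^ t in the Taylor series of (1 - z) ^ (-1/2), that is
    the rising factorial of 1/2 divided by t!. *)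
Definition half_coef (t : nat) : R := (\prod_(i < t) (1 / 2 + i%:R)) / t`!%:R.

Lemma half_coef0 : half_coef 0 = 1.
Proof. by rewrite /half_coef big_ord0 fact0 divr1. Qed.

Lemma half_coefS t : half_coef t.+1 * t.+1%:R = half_coef t * (1 / 2 + t%:R).
Proof.
rewrite /half_coef big_ord_recr /= factS natrM.
rewrite -nat1r; have t0 : 1 + t%:R != 0 :> R by rewrite nat1r pnatr_eq0.
have f0 : t`!%:R != 0 :> R by rewrite pnatr_eq0 -lt0n fact_gt0.
by field; rewrite f0 t0.
Qed.

Lemma half_coef_ge0 t : 0 <= half_coef t.
Proof.
by rewrite divr_ge0// prodr_ge0// => i _; rewrite addr_ge0// divr_ge0.
Qed.

Lemma half_coef_nonincr t : half_coef t.+1 <= half_coef t.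
Proof.
have t0 : 0 < t.+1%:R :> R by rewrite ltr0n.
rewrite -(ler_pM2r t0) half_coefS ler_wpM2l ?half_coef_ge0//.
by rewrite -(natr1 t); lra.
Qed.

(** The square of the series is the geometric series. Write c_n for the sum and
    w_n for the same sum weighted by i. The symmetry i <-> n - i gives
    2 w_n = n c_n, and the recurrence of the coefficients gives
    w_(n+1) = w_n + c_n / 2, hence (n + 1) c_(n+1) = (n + 1) c_n. *)
Lemma half_coef_conv n : \sum_(i < n.+1) half_coef i * half_coef (n - i) = 1.
Proof.
elim: n => [|n IH]; first by rewrite big_ord1 /= subn0 half_coef0 mulr1.
have n0 : n.+1%:R != 0 :> R by rewrite pnatr_eq0.
pose c m := \sum_(i < m.+1) half_coef i * half_coef (m - i).
pose w m := \sum_(i < m.+1) i%:R * (half_coef i * half_coef (m - i)).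
have wE m : 2 * w m = m%:R * c m.
  have -> : 2 * w m = w m + w m by ring.
  rewrite {2}/w (reindex_inj rev_ord_inj) /= /w -big_split /= mulr_sumr.
  apply: eq_bigr => i _; rewrite subSS subKn ?leq_ord//.
  rewrite [half_coef (m - i) * _]mulrC -mulrDl -natrD subnKC ?leq_ord//.
have wS : w n.+1 = w n + c n / 2.
  rewrite {1}/w big_ord_recl /= mul0r add0r /w /c mulr_suml -big_split /=.
  apply: eq_bigr => i _; rewrite /bump /= add1n subSS mulrA.
  by rewrite [_ * half_coef i.+1]mulrC half_coefS; lra.
apply: (mulfI n0); rewrite -/(c n.+1) -wE wS mulrDr wE -/(c n) /c IH.
by rewrite -(natr1 n); lra.
Qed.

Implicit Type z : R[i].

Definition half_sum z N := \sum_(t < N) (half_coef t)%:C%C * z ^+ t.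

(** This selects the branch of the square root. By summation by parts the
    left-hand side is a combination of powers z ^ t, t > 0, whose coefficients
    have a fixed sign, the coefficients of the series being decreasing; their
    absolute values telescope to the coefficient of index 0, which is 1. *)
Lemma half_sum_near1 z N : `|z| <= 1 ->
  `|(1 - z) * half_sum z N.+1 - 1| <= `|z|.
Proof.
move=> z1.
have E : (1 - z) * half_sum z N.+1 - 1 =
    - \sum_(t < N) (half_coef t - half_coef t.+1)%:C%C * z ^+ t.+1
    - (half_coef N)%:C%C * z ^+ N.+1.
  elim: N => [|N IH].
    by rewrite /half_sum big_ord1 big_ord0 half_coef0 /= expr0 expr1; ring.
  rewrite /half_sum big_ord_recr /= mulrDr addrAC -/(half_sum z N.+1) IH.
  by rewrite [\sum_(i < N.+1) _]big_ord_recr /= rmorphB /= !exprS; ring.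
have zn t : `|z ^+ t.+1| <= `|z|.
  by rewrite normrX exprS ler_piMr// exprn_ile1.
rewrite E; apply: le_trans (ler_normB _ _) _; rewrite normrN.
have -> : `|z| = \sum_(t < N) (half_coef t - half_coef t.+1)%:C%C * `|z|
    + (half_coef N)%:C%C * `|z|.
  rewrite -mulr_suml -mulrDl -[LHS]mul1r; congr (_ * _).
  elim: N {E} => [|N IH]; first by rewrite big_ord0 half_coef0 add0r.
  by rewrite big_ord_recr /= rmorphB /= -addrA subrK.
apply: lerD.
  apply: le_trans (ler_norm_sum _ _ _) _; apply: ler_sum => t _.
  rewrite normrM normc_real ?subr_ge0 ?half_coef_nonincr//.
  by rewrite ler_wpM2l// ler0c subr_ge0 half_coef_nonincr.
rewrite normrM normc_real ?half_coef_ge0//.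
by rewrite ler_wpM2l// ler0c half_coef_ge0.
Qed.

Let half_poly N : {poly R[i]} := \poly_(i < N) (half_coef i)%:C%C.

(** The coefficients of the squared truncation are those of the geometric series
    below N and stay between 0 and 1 beyond. *)
Let half_poly_coef N n : exists2 c : R, (half_poly N * half_poly N)`_n = c%:C%C
  & 0 <= c <= 1 /\ ((n < N)%N -> c = 1).
Proof.
pose a i : R := if (i < N)%N then half_coef i else 0.
have a0 i : 0 <= a i by rewrite /a; case: ifP => // _; exact: half_coef_ge0.
have al i : a i <= half_coef i.
  by rewrite /a; case: ifP => // _; exact: half_coef_ge0.
exists (\sum_(i < n.+1) a i * a (n - i)%N).
  have cE i : (half_poly N)`_i = (a i)%:C%C by rewrite coef_poly /a; case: ifP.
  by rewrite coefM rmorph_sum; apply: eq_bigr => i _; rewrite !cE rmorphM.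
split.
  apply/andP; split; first by apply: sumr_ge0 => i _; rewrite mulr_ge0.
  by rewrite -(half_coef_conv n) ler_sum// => i _; rewrite ler_pM.
move=> nN; rewrite -(half_coef_conv n); apply: eq_bigr => i _.
rewrite /a !ifT//; first by apply: leq_ltn_trans nN; exact: leq_subr.
by apply: leq_ltn_trans nN; exact: leq_ord.
Qed.

(** The error comes from the coefficients of index between N and 2 N of the
    squared truncation; it is multiplied by 1 - |z| to avoid a denominator. *)
Lemma half_sum_sqr_near z N : `|z| < 1 ->
  (1 - `|z|) * `|(1 - z) * half_sum z N ^+ 2 - 1| <= 3 * `|z| ^+ N.
Proof.
move=> z1.
have hE : half_sum z N = (half_poly N).[z] by rewrite horner_poly.
have sz : (size (half_poly N * half_poly N)%R <= N + N)%N.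
  apply: leq_trans (size_polyMleq _ _) _; apply: leq_trans (leq_pred _) _.
  by rewrite leq_add// size_poly.
rewrite expr2 hE -hornerM (horner_coef_wide _ sz) big_split_ord /=.
set u := \sum_(i < N) _; set v := \sum_(i < N) _.
have uE : (1 - z) * u = 1 - z ^+ N.
  rewrite -[RHS]opprB subrX1 -mulNr opprB; congr (_ * _); apply: eq_bigr => i _.
  by have [c -> [_ ->//]] := half_poly_coef N i; rewrite mul1r.
have vE : (1 - `|z|) * `|v| <= `|z| ^+ N.
  have vl : `|v| <= `|z| ^+ N * \sum_(i < N) `|z| ^+ i.
    apply: le_trans (ler_norm_sum _ _ _) _; rewrite mulr_sumr.
    apply: ler_sum => i _; have [c -> [/andP[c0 c1] _]] := half_poly_coef N (N + i).
    rewrite normrM normrX normc_real// -exprD ler_piMl ?exprn_ge0//.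
    by rewrite -(rmorph1 (real_complex R)) lecR.
  have z1' : 0 <= 1 - `|z| by rewrite subr_ge0 ltW.
  apply: le_trans (ler_wpM2l z1' vl) _; rewrite mulrCA.
  have -> : (1 - `|z|) * (\sum_(i < N) `|z| ^+ i) = 1 - `|z| ^+ N.
    by rewrite -[RHS]opprB subrX1 -mulNr opprB.
  by rewrite ler_piMr ?exprn_ge0// gerBl exprn_ge0.
have -> : (1 - z) * (u + v) - 1 = - z ^+ N + (1 - z) * v.
  by rewrite mulrDr uE; ring.
have z1' : 0 <= 1 - `|z| by rewrite subr_ge0 ltW.
apply: le_trans (ler_wpM2l z1' (ler_normD _ _)) _.
rewrite normrN normrX mulrDr normrM mulrCA.
have -> : 3 * `|z| ^+ N = 1 * `|z| ^+ N + 2 * `|z| ^+ N by ring.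
apply: lerD.
  by rewrite ler_wpM2r ?exprn_ge0// gerBl.
rewrite ler_pM ?mulr_ge0//.
apply: le_trans (ler_normB _ _) _; rewrite normr1.
by rewrite (_ : 2 = 1 + 1)// lerD2l ltW.
Qed.

(** U = (1 - z) E satisfies U ^ 2 = 1 - z and Re U >= 1 - |z| > 0, so U is the
    principal square root of 1 - z, and E = U / U ^ 2. *)
Lemma half_series_limit z E : `|z| < 1 -> ccvg (half_sum z) E ->
  E = (sqrtc (1 - z))^-1.
Proof.
move=> z1 SE; pose r := complex.Re `|z|.
have rE : `|z| = r%:C%C by rewrite /r normc_def.
have r0 : 0 <= r by rewrite -ler0c -rE.
have r1 : r < 1 by rewrite -ltcR -rE.
have r1' : 0 < 1 - r by rewrite subr_gt0.
have S1 : ccvg (fun n => (1 - z) * (half_sum z n * half_sum z n)) 1.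
  apply: (@ccvg_geometric _ _ _ (3 / (1 - r)) r); first by rewrite ger0_norm.
  move=> n; have r1c : 0 < 1 - `|z| by rewrite subr_gt0.
  rewrite -(ler_pM2l r1c); apply: le_trans (half_sum_sqr_near n z1) _.
  rewrite rE -(rmorph1 (real_complex R)) -rmorphB -rmorphM -rmorphXn /=.
  rewrite mulrA mulrCA divff ?gt_eqF// mulr1.
  by rewrite rmorphM (rmorph_nat (real_complex R)).
have E1 : (1 - z) * (E * E) = 1.
  by apply: (ccvg_unique _ S1); do ![apply: ccvgM => //|exact: ccvg_cst].
have z0 : 1 - z != 0.
  by apply/eqP => h; move/eqP : E1; rewrite h mul0r eq_sym oner_eq0.
have U2 : ((1 - z) * E) ^+ 2 = 1 - z by rewrite expr2 mulrACA -mulrA E1 mulr1.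
have [U0 _] : ccvg (fun n => (1 - z) * half_sum z n) ((1 - z) * E).
  by apply: ccvgM => //; exact: ccvg_cst.
have {}U0 : 1 - r <= complex.Re ((1 - z) * E).
  apply: (cvgr_to_ge U0); exists 1%N => // -[//|n] _ /=.
  have := half_sum_near1 n (ltW z1); rewrite rE => /normc_Re_le.
  case: ((1 - z) * _) => a b /=; rewrite ler_norml => /andP[+ _].
  by rewrite lerBrDr addrC.
rewrite -(sqrtc_unique U2); last exact: lt_le_trans U0.
have E0 : E != 0.
  by apply/eqP => h; move/eqP : E1; rewrite h !mulr0 eq_sym oner_eq0.
apply: (mulfI z0); rewrite invfM mulrA mulfV// mul1r.
by apply: (mulIf E0); rewrite mulVf// -mulrA.
Qed.

End half_binomial_series.

(** * Measurable complex functions and their integrals *)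

Section complex_measurable_functions.
Context d (T : measurableType d) (R : realType).
Implicit Types f g : T -> R[i].

Lemma measurable_fun_Re f : measurable_fun setT f ->
  measurable_fun setT (fun t => complex.Re (f t)).
Proof. by move=> mf; apply: measurableT_comp mf; exact: measurable_Re. Qed.

Lemma measurable_fun_Im f : measurable_fun setT f ->
  measurable_fun setT (fun t => complex.Im (f t)).
Proof. by move=> mf; apply: measurableT_comp mf; exact: measurable_Im. Qed.

Lemma measurable_fun_complexM f g : measurable_fun setT f ->
  measurable_fun setT g -> measurable_fun setT (fun t => f t * g t).
Proof.
move=> mf mg; have [rf rg] := (measurable_fun_Re mf, measurable_fun_Re mg).
have [jf jg] := (measurable_fun_Im mf, measurable_fun_Im mg).
apply: measurable_fun_complexP.
  under eq_fun do rewrite Re_mulc.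
  by apply: measurable_funB; apply: measurable_funM.
under eq_fun do rewrite Im_mulc.
by apply: measurable_funD; apply: measurable_funM.
Qed.

Lemma measurable_fun_complexD f g : measurable_fun setT f ->
  measurable_fun setT g -> measurable_fun setT (fun t => f t + g t).
Proof.
move=> mf mg; have [rf rg] := (measurable_fun_Re mf, measurable_fun_Re mg).
have [jf jg] := (measurable_fun_Im mf, measurable_fun_Im mg).
apply: measurable_fun_complexP.
  by under eq_fun do rewrite Re_addc; apply: measurable_funD.
by under eq_fun do rewrite Im_addc; apply: measurable_funD.
Qed.

Lemma measurable_fun_complex_prod (I : Type) (s : seq I) (F : I -> T -> R[i]) :
  (forall i, measurable_fun setT (F i)) ->
  measurable_fun setT (fun t => \prod_(i <- s) F i t).
Proof.
move=> mF; elim: s => [|i s IH].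
  by under eq_fun do rewrite big_nil; exact: measurable_cst.
by under eq_fun do rewrite big_cons; exact: measurable_fun_complexM.
Qed.

Lemma measurable_fun_complex_sum (I : Type) (s : seq I) (F : I -> T -> R[i]) :
  (forall i, measurable_fun setT (F i)) ->
  measurable_fun setT (fun t => \sum_(i <- s) F i t).
Proof.
move=> mF; elim: s => [|i s IH].
  by under eq_fun do rewrite big_nil; exact: measurable_cst.
by under eq_fun do rewrite big_cons; exact: measurable_fun_complexD.
Qed.

Lemma measurable_fun_complexX f n : measurable_fun setT f ->
  measurable_fun setT (fun t => f t ^+ n).
Proof.
move=> mf; elim: n => [|n IH].
  by under eq_fun do rewrite expr0; exact: measurable_cst.
by under eq_fun do rewrite exprS; exact: measurable_fun_complexM.
Qed.

End complex_measurable_functions.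

Lemma closed_discE (R : realType) : closed_disc R =
  [set z | complex.Re z ^+ 2 + complex.Im z ^+ 2 <= 1].
Proof.
apply/funext => z; rewrite /closed_disc /= normc_def; apply/propext.
by rewrite -(rmorph1 (real_complex R)) lecR -[X in _ <= X <-> _]sqrtr1 ler_sqrt.
Qed.

Lemma measurable_closed_disc (R : realType) : measurable (closed_disc R).
Proof.
rewrite closed_discE.
have mn : measurable_fun [set: R[i]]
    (fun z => complex.Re z ^+ 2 + complex.Im z ^+ 2).
  by apply: measurable_funD; apply: measurable_funX;
    [exact: measurable_Re|exact: measurable_Im].
have := mn measurableT _ (measurable_itv `]-oo, 1]%R); rewrite setTI.
by congr (measurable _); apply/seteqP; split => z /=; rewrite in_itv.
Qed.

Section complex_integral_theory.
Context d (T : measurableType d) (R : realType).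
Implicit Types f g : T -> R[i].

Definition cintegrable (mu : {measure set T -> \bar R}) f : Prop :=
  mu.-integrable setT (EFin \o (fun t => complex.Re (f t))) /\
  mu.-integrable setT (EFin \o (fun t => complex.Im (f t))).

Section linearity.
Variable mu : {measure set T -> \bar R}.

Lemma cintegrableD f g : cintegrable mu f -> cintegrable mu g ->
  cintegrable mu (fun t => f t + g t).
Proof.
move=> [f1 f2] [g1 g2]; split; rewrite /comp.
  under eq_fun do rewrite Re_addc EFinD; exact: integrableD.
by under eq_fun do rewrite Im_addc EFinD; exact: integrableD.
Qed.

Lemma cintegrableZ f (a : R[i]) : cintegrable mu f ->
  cintegrable mu (fun t => a * f t).
Proof.
move=> [f1 f2]; split; rewrite /comp.
  under eq_fun do rewrite Re_mulc EFinB !EFinM.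
  by apply: integrableB => //; exact: integrableZl.
under eq_fun do rewrite Im_mulc EFinD !EFinM.
by apply: integrableD => //; exact: integrableZl.
Qed.

Lemma cintegralD f g : cintegrable mu f -> cintegrable mu g ->
  cintegral mu (fun t => f t + g t) = cintegral mu f + cintegral mu g.
Proof.
move=> [f1 f2] [g1 g2]; congr (_ +i* _)%C.
  by under eq_Rintegral do rewrite Re_addc; rewrite RintegralD.
by under eq_Rintegral do rewrite Im_addc; rewrite RintegralD.
Qed.

Lemma cintegralZ f (a : R[i]) : cintegrable mu f ->
  cintegral mu (fun t => a * f t) = a * cintegral mu f.
Proof.
move=> [f1 f2].
have Z (c : R) (h : T -> R) : mu.-integrable setT (EFin \o h) ->
    mu.-integrable setT (EFin \o (fun t => c * h t)).
  by move=> ih; rewrite /comp; under eq_fun do rewrite EFinM; exact: integrableZl.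
rewrite [RHS](_ : _ = ((complex.Re a * \int[mu]_t complex.Re (f t)
    - complex.Im a * \int[mu]_t complex.Im (f t)) +i*
  (complex.Re a * \int[mu]_t complex.Im (f t)
    + complex.Im a * \int[mu]_t complex.Re (f t)))%C); last by case: a.
congr (_ +i* _)%C.
  under eq_Rintegral do rewrite Re_mulc.
  by rewrite RintegralB; [rewrite !RintegralZl|by []|exact: Z..].
under eq_Rintegral do rewrite Im_mulc.
by rewrite RintegralD; [rewrite !RintegralZl|by []|exact: Z..].
Qed.

End linearity.
End complex_integral_theory.

Section bounded_complex_integral.
Context d (T : measurableType d) (R : realType).
Implicit Types f g : T -> R[i].

Lemma fine_probability_setT (P : probability T R) : fine (P [set: T]) = 1.
Proof. by have -> : P [set: T] = 1%E by exact: probability_setT. Qed.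

Lemma bounded_integrable (P : probability T R) (h : T -> R) (K : R) :
  measurable_fun setT h -> (forall t, `|h t| <= K) ->
  P.-integrable setT (EFin \o h).
Proof.
move=> mh hK; apply: measurable_bounded_integrable => //.
  by rewrite -ge0_fin_numE // fin_num_measure.
exists K; split; first exact: num_real.
by move=> M KM t _ /=; apply: le_trans (hK t) (ltW KM).
Qed.

Lemma cbounded_integrable (P : probability T R) f (K : R) :
  measurable_fun setT f -> (forall t, `|f t| <= K%:C%C) -> cintegrable P f.
Proof.
move=> mf fK; split; apply: (@bounded_integrable _ _ K).
- exact: measurable_fun_Re.
- by move=> t; exact: normc_Re_le.
- exact: measurable_fun_Im.
- by move=> t; exact: normc_Im_le.
Qed.

Lemma cintegral_cst (P : probability T R) (a : R[i]) :
  cintegral P (fun=> a) = a.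
Proof.
by rewrite /cintegral !Rintegral_cst// fine_probability_setT !mulr1; case: a.
Qed.

(** With c the integral, |c| ^ 2 = Re (conj c * c) is the integral of
    Re (conj c * f), which is at most |c|. *)
Lemma cintegral_le1 (P : probability T R) f :
  measurable_fun setT f -> (forall t, `|f t| <= 1) -> `|cintegral P f| <= 1.
Proof.
move=> mf f1; set c := cintegral P f.
have mcf : measurable_fun setT (fun t => c^*%C * f t).
  by apply: measurable_fun_complexM => //; exact: measurable_cst.
have cN : `|c| = (complex.Re `|c|)%:C%C by rewrite normc_def.
have f1' t : `|f t| <= 1%:C%C by rewrite rmorph1.
have cf t : `|c^*%C * f t| <= (complex.Re `|c|)%:C%C.
  by rewrite -cN normrM normcJ ler_piMr.
have ci := cbounded_integrable P mcf cf.
have := cintegralZ c^*%C (cbounded_integrable P mf f1').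
rewrite -/c => h; have {}h : complex.Re (cintegral P (fun t => c^*%C * f t))
    = complex.Re `|c| ^+ 2.
  rewrite h mulrC -sqr_normc cN -rmorphXn //.
have le : complex.Re `|c| ^+ 2 <= complex.Re `|c|.
  rewrite -h /= -[leRHS]mulr1 -[X in _ <= _ * X](_ : fine (P setT) = 1); last first.
    exact: fine_probability_setT.
  rewrite -Rintegral_cst//; apply: le_Rintegral => //; first by case: ci.
    by apply: (@bounded_integrable _ _ (complex.Re `|c|)) => // t;
      rewrite ger0_norm// -ler0c -cN.
  by move=> t _; apply: le_trans (ler_norm _) (normc_Re_le (cf t)).
rewrite cN -(rmorph1 (real_complex R)) lecR; move: le.
have [//|] := leP (complex.Re `|c|) 1.
move=> c1; rewrite expr2 leNgt -subr_gt0 -{3}[complex.Re _]mulr1 -mulrBr.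
by rewrite mulr_gt0 ?subr_gt0// (lt_trans _ c1).
Qed.

End bounded_complex_integral.

Section null_modification.
Context d (T : measurableType d) (R : realType).
Variable mu : {measure set T -> \bar R}.
Variables (N : set T) (mN : measurable N) (muN : mu N = 0%E).
Local Open Scope ereal_scope.
Import HBNNSimple.

(** A simple function below f, set to 0 on the null set N, lies below g and has
    the same integral. *)
Let ge0_integral_eq_le (f g : T -> \bar R) : (forall x, 0 <= f x) ->
  (forall x, 0 <= g x) -> (forall x, ~ N x -> f x = g x) ->
  \int[mu]_x f x <= \int[mu]_x g x.
Proof.
move=> f0 g0 fg; rewrite !ge0_integralTE//; apply: ge_ereal_sup => _ [h /= hf <-].
have mNc : measurable (~` N) by exact: measurableC.
pose h' : {nnsfun T >-> R} := [the {nnsfun T >-> R} of proj_nnsfun h mNc].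
apply: (@le_trans _ _ (sintegral mu h')); last first.
  apply: ereal_sup_ubound; exists h' => // x /=.
  rewrite mindicE; have [xN|xN] := boolP (x \in ~` N).
    by rewrite mulr1 -fg ?hf//; move: xN; rewrite inE.
  by rewrite mulr0.
rewrite -!integralT_nnsfun; rewrite le_eqVlt; apply/orP; left; apply/eqP.
apply: ge0_ae_eq_integral => //.
- exact/measurable_EFinP.
- exact/measurable_EFinP.
- by move=> x _; rewrite lee_fin.
- by move=> x _; rewrite lee_fin.
exists N; split => // x /= xh; apply: contrapT => nN; apply: xh => _.
by rewrite mindicE mem_set ?mulr1.
Qed.

(** The integral of a function, measurable or not, is a difference of suprema
    over simple functions, and these do not see a null set. *)
Lemma integral_null_eq (f g : T -> \bar R) :
  (forall x, ~ N x -> f x = g x) -> \int[mu]_x f x = \int[mu]_x g x.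
Proof.
move=> fg; rewrite integralE [RHS]integralE.
congr (_ - _); apply/eqP; rewrite eq_le; apply/andP; split;
  apply: ge0_integral_eq_le => // x nN; rewrite ?funeposE ?funenegE fg//.
Qed.

Lemma cintegral_null_eq (f g : T -> R[i]) :
  (forall x, ~ N x -> f x = g x) -> cintegral mu f = cintegral mu g.
Proof.
by move=> fg; congr (_ +i* _)%C; congr fine; apply: integral_null_eq => x nN;
  rewrite fg.
Qed.

End null_modification.

Section complex_integral_transfer.
Context d d' (T : measurableType d) (T' : measurableType d') (R : realType).
Variable P : probability T R.

Lemma cintegral_distribution (X : {RV P >-> T'}) (f : T' -> R[i]) :
  measurable_fun setT f -> cintegrable P (f \o X) ->
  cintegral (distribution P X) f = cintegral P (f \o X).
Proof.
move=> mf [i1 i2]; congr (_ +i* _)%C; congr fine; rewrite integral_distribution//.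
  by apply/measurable_EFinP; exact: measurable_fun_Re.
by apply/measurable_EFinP; exact: measurable_fun_Im.
Qed.

Lemma ccvg_cintegral (u : nat -> T -> R[i]) (f : T -> R[i]) :
  (forall n, measurable_fun setT (u n)) -> measurable_fun setT f ->
  (forall n t, `|u n t| <= 1) -> (forall t, ccvg (u ^~ t) (f t)) ->
  ccvg (fun n => cintegral P (u n)) (cintegral P f).
Proof.
move=> mu mf u1 uf; have i1 : P.-integrable setT (EFin \o cst (1 : R)).
  by apply: (@bounded_integrable _ _ _ _ _ 1) => // t; rewrite normr1.
have D (v : nat -> T -> R) (w : T -> R) : (forall n, measurable_fun setT (v n)) ->
    measurable_fun setT w -> (forall n t, `|v n t| <= 1) ->
    (forall t, v n t @[n --> \oo] --> w t) ->
    (\int[P]_t v n t)%R @[n --> \oo] --> (\int[P]_t w t)%R.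
  move=> mv mw v1 vw.
  have h : (\int[P]_t (v n t)%:E)%E @[n --> \oo] --> (\int[P]_t (w t)%:E)%E.
    apply: (@dominated_cvg _ _ _ P _ measurableT (fun n => EFin \o v n)
      (EFin \o w) (EFin \o cst 1)) => //.
    - by move=> n; apply/measurable_EFinP; exact: mv.
    - by move=> t _; apply: cvg_EFin; [exact: nearW|exact: vw].
    - by move=> n t _; rewrite lee_fin.
  apply: fine_cvg; rewrite fineK//.
  apply: integrable_fin_num => //; apply: (@bounded_integrable _ _ _ _ _ 1) => // t.
  apply: (cvgr_to_le (cvg_norm (vw t))).
  by apply: nearW => n; exact: v1.
split; apply: D => [n||n t|t].
- exact: measurable_fun_Re.
- exact: measurable_fun_Re.
- by apply: normc_Re_le; rewrite rmorph1.
- by have [] := uf t.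
- exact: measurable_fun_Im.
- exact: measurable_fun_Im.
- by apply: normc_Im_le; rewrite rmorph1.
- by have [] := uf t.
Qed.

End complex_integral_transfer.

(** * Independence *)

Section pair_law.
Context d d0 d1 (W : measurableType d) (E0 : measurableType d0)
  (E : measurableType d1) (R : realType) (P : probability W R).
Local Open Scope ereal_scope.

(** The restriction to the event D keeps the remaining variables available when
    the lemma is applied inside an induction on independent variables. *)
Lemma pair_law (D : set W) (Z : W -> E0) (Y : W -> E)
    (L : probability E0 R) (N : probability E R) (p : R) :
  measurable D -> measurable_fun setT Z -> measurable_fun setT Y -> (0 <= p)%R ->
  (forall A B, measurable A -> measurable B ->
    P (D `&` (Z @^-1` A `&` Y @^-1` B)) = p%:E * (L A * N B)) ->
  forall C, measurable C ->
    P (D `&` [set w | C (Z w, Y w)]) = p%:E * (L \x N) C.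
Proof.
move=> mD mZ mY p0 PE C mC.
have mZY : measurable_fun setT (fun w => (Z w, Y w)).
  exact/measurable_fun_pairP.
have mC' : measurable [set w | C (Z w, Y w)].
  by rewrite -[X in measurable X]setTI; exact: mZY.
have [p_eq0|p_neq0] := eqVneq p 0%R.
  have PD : P D = 0.
    have := PE _ _ measurableT measurableT.
    by rewrite !preimage_setT !setIT p_eq0 mul0e.
  rewrite p_eq0 mul0e; apply/eqP; rewrite eq_le measure_ge0 andbT -PD.
  by apply: le_measure; rewrite ?inE//; exact: measurableI.
have pV : (0 <= p^-1)%R by rewrite invr_ge0.
pose m := pushforward (mrestr P mD) (fun w => (Z w, Y w)).
pose m' := mscale (NngNum pV) m.
have -> // : (L \x N) C = m' mZY C.
  apply: product_measure_unique => // A B mA mB.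
  rewrite /m' /mscale /= /m /pushforward /mrestr /=.
  transitivity (p^-1%:E * P (D `&` (Z @^-1` A `&` Y @^-1` B))).
    by congr (_ * P _); rewrite setIC.
  by rewrite PE// muleA -EFinM mulVf// mul1e.
rewrite /m' /mscale /= /m /pushforward /mrestr /= muleA -EFinM divff// mul1e.
by congr (P _); rewrite setIC.
Qed.

End pair_law.

Section independent_fold.
Context d d0 d1 (W : measurableType d) (E0 : measurableType d0)
  (E : measurableType d1) (R : realType) (P : probability W R).
Variables (I : eqType) (X : I -> {RV P >-> E}) (F : set (set W)).
Hypothesis FT : F setT.
Hypothesis mF : forall D, F D -> measurable D.
Hypothesis indep : forall (D : set W) (K : seq I) (B : I -> set E), F D ->
  uniq K -> (forall k, measurable (B k)) ->
  P (D `&` \bigcap_(k in [set` K]) (X k @^-1` B k)) =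
    (P D * \prod_(k <- K) P (X k @^-1` B k))%E.
Variables (op : I -> E0 -> E -> E0) (s0 : E0).
Hypothesis mop : forall i, measurable_fun setT (fun z : E0 * E => op i z.1 z.2).

(** The state reached from s0 by feeding the variables indexed by J to the
    transition op; partial sums and partial products are instances. *)
Definition fold_rv (J : seq I) (w : W) : E0 :=
  foldr (fun j s => op j s (X j w)) s0 J.

Lemma measurable_fold_rv J : measurable_fun setT (fold_rv J).
Proof.
elim: J => [|j J IH]; first exact: measurable_cst.
rewrite (_ : fold_rv _ = (fun z : E0 * E => op j z.1 z.2) \o
  (fun w => (fold_rv J w, X j w)))//.
by apply: measurableT_comp => //; apply: measurable_fun_pair.
Qed.

HB.instance Definition _ J :=
  isMeasurableFun.Build _ _ _ _ (fold_rv J) (measurable_fold_rv J).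

Let mcap (K : seq I) (B : I -> set E) : (forall k, measurable (B k)) ->
  measurable (\bigcap_(k in [set` K]) (X k @^-1` B k)).
Proof.
move=> mB; apply: fin_bigcap_measurable => // k _.
by rewrite -[X in measurable X]setTI; exact: measurable_funPT.
Qed.

Let cap_cons j (K : seq I) (B : I -> set E) (B0 : set E) : j \notin K ->
  \bigcap_(k in [set` j :: K]) (X k @^-1` (if k == j then B0 else B k)) =
  X j @^-1` B0 `&` \bigcap_(k in [set` K]) (X k @^-1` B k).
Proof.
move=> jK; apply/seteqP; split => w /=.
  move=> h; split; first by have := h j (mem_head _ _); rewrite /= eqxx.
  move=> k kK; have kjK : k \in j :: K by rewrite in_cons [k \in K]kK orbT.
  have /= := h k kjK; rewrite (_ : k == j = false)//.
  by apply: contraNF jK => /eqP <-.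
move=> [h1 h2] k kjK; have : k \in j :: K by exact: kjK.
by rewrite in_cons /=; case: eqVneq => [-> _//|kj /= kK]; exact: h2.
Qed.

(** By induction on J: the state after the variables of J, the next variable and
    the events attached to K are independent by the induction hypothesis, so
    the pair (state, next variable) has a product law on each event considered,
    and the new state is a function of this pair. *)
Lemma independent_fold (J : seq I) : forall (D : set W) (K : seq I)
  (A : set E0) (B : I -> set E),
  F D -> uniq (J ++ K) -> measurable A -> (forall k, measurable (B k)) ->
  P (D `&` (fold_rv J @^-1` A `&` \bigcap_(k in [set` K]) (X k @^-1` B k))) =
    (P D * (P (fold_rv J @^-1` A) * \prod_(k <- K) P (X k @^-1` B k)))%E.
Proof.
elim: J => [|j J IH] D K A B FD uJK mA mB.
  have [As0|nAs0] := pselect (A s0).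
    have -> : fold_rv [::] @^-1` A = setT by apply/seteqP; split.
    by rewrite setTI probability_setT mul1e; exact: indep.
  have -> : fold_rv [::] @^-1` A = set0 by apply/seteqP; split.
  by rewrite set0I setI0 !measure0 mul0e mule0.
move: uJK => /= /andP[jJK uJK].
have jK : j \notin K by apply: contra jJK; rewrite mem_cat => ->; rewrite orbT.
have uJjK : uniq (J ++ j :: K).
  by rewrite -cat1s uniq_catCA /= jJK.
have uJj : uniq (J ++ [:: j]).
  by move: uJjK; rewrite -cat1s catA cat_uniq => /andP[].
pose C := [set z : E0 * E | A (op j z.1 z.2)].
have mC : measurable C.
  by rewrite -[X in measurable X]setTI; exact: mop.
have fin (D' : set W) : measurable D' -> P D' = (fine (P D'))%:E.
  by move=> mD'; rewrite fineK// fin_num_measure.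
have main (D' : set W) (K' : seq I) : F D' -> uniq (J ++ j :: K') -> j \notin K' ->
    P (D' `&` (fold_rv (j :: J) @^-1` A `&`
       \bigcap_(k in [set` K']) (X k @^-1` B k))) =
    (P D' * \prod_(k <- K') P (X k @^-1` B k) *
      (distribution P (fold_rv J) \x distribution P (X j)) C)%E.
  move=> FD' uK' jK'; set EK := \bigcap_(k in _) _.
  have mEK : measurable EK by exact: mcap.
  have PEK : (P D' * \prod_(k <- K') P (X k @^-1` B k) = P (D' `&` EK))%E.
    rewrite -indep//; move: uK'.
    by rewrite cat_uniq => /and3P[_ _ /= /andP[]].
  have mDE : measurable (D' `&` EK) by apply: measurableI => //; exact: mF.
  rewrite PEK (fin _ mDE) -(@pair_law _ _ _ _ _ _ _ P (D' `&` EK) (fold_rv J) (X j)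
    (distribution P (fold_rv J)) (distribution P (X j)))//.
  - by congr (P _); rewrite -setIA; congr (_ `&` _); rewrite setIC.
  - exact: fine_ge0.
  move=> A' B' mA' mB'; rewrite -(fin _ mDE) -PEK /distribution /pushforward.
  have := IH D' (j :: K') A' (fun k => if k == j then B' else B k) FD' uK' mA'.
  rewrite cap_cons// big_cons eqxx.
  have -> : (\prod_(k <- K') P (X k @^-1` (if k == j then B' else B k)) =
      \prod_(k <- K') P (X k @^-1` B k))%E.
    rewrite big_seq [RHS]big_seq; apply: eq_bigr => k kK'.
    by rewrite ifF//; apply: contraNF jK' => /eqP <-.
  move=> h.
  transitivity (P (D' `&` (fold_rv J @^-1` A' `&` (X j @^-1` B' `&` EK)))).
    by congr (P _); rewrite -setIA; congr (_ `&` _); rewrite setIC -setIA.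
  rewrite h; last by move=> k; case: ifP.
  rewrite -!muleA; congr (_ * _)%E.
  by rewrite [RHS]muleC muleA.
have L : P (fold_rv (j :: J) @^-1` A) =
    (distribution P (fold_rv J) \x distribution P (X j))%E C.
  have := main setT [::] FT uJj isT.
  by rewrite set_nil bigcap_set0 setIT setTI big_nil probability_setT !mul1e.
by rewrite main// -L -muleA; congr (_ * _)%E; rewrite muleC.
Qed.

End independent_fold.

Section independent_product.
Context d d0 d1 (W : measurableType d) (E0 : measurableType d0)
  (E : measurableType d1) (R : realType) (P : probability W R).
Variables (Z : W -> E0) (Y : W -> E).
Hypotheses (mZ : measurable_fun setT Z) (mY : measurable_fun setT Y).
Hypothesis ZY : forall A B, measurable A -> measurable B ->
  P (Z @^-1` A `&` Y @^-1` B) = (P (Z @^-1` A) * P (Y @^-1` B))%E.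

Let Rintegral_indepM (u : E0 -> R) (v : E -> R) :
  measurable_fun setT u -> measurable_fun setT v ->
  (forall x, `|u x| <= 1) -> (forall y, `|v y| <= 1) ->
  \int[P]_w (u (Z w) * v (Y w)) = (\int[P]_w u (Z w)) * (\int[P]_w v (Y w)).
Proof.
move=> mu mv u1 v1.
pose L := distribution P (HB.pack_for {mfun W >-> E0} Z
  (isMeasurableFun.Build _ _ _ _ Z mZ)).
pose N := distribution P (HB.pack_for {mfun W >-> E} Y
  (isMeasurableFun.Build _ _ _ _ Y mY)).
have mZY : measurable_fun setT (fun w => (Z w, Y w)).
  exact: measurable_fun_pair.
pose h (z : E0 * E) := u z.1 * v z.2.
have mh : measurable_fun setT h.
  by apply: measurable_funM; apply: measurableT_comp.
have h1 z : `|h z| <= 1.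
  by rewrite normrM mulr_ile1.
have law C : measurable C -> P [set w | C (Z w, Y w)] = (L \x N)%E C.
  move=> mC; have := @pair_law _ _ _ _ _ _ _ P setT Z Y L N 1 measurableT mZ mY
    ler01 _ C mC.
  by rewrite setTI mul1e; apply => A B mA mB; rewrite setTI mul1e ZY.
have E1 : (\int[P]_w (h (Z w, Y w))%:E = \int[L \x N]_z (h z)%:E)%E.
  rewrite -[LHS](@integral_pushforward _ _ _ _ _ _ mZY P setT (EFin \o h))//.
  - apply: eq_measure_integral => C mC _.
    exact: law.
  - exact/measurable_EFinP.
  - rewrite preimage_setT.
    by apply: (@bounded_integrable _ _ _ P (fun w => h (Z w, Y w)) 1) => //;
      apply: measurableT_comp.
have E2 : (\int[L \x N]_z (h z)%:E = \int[L]_x \int[N]_y (u x * v y)%:E)%E.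
  rewrite -(@integral12_prod_meas1 _ _ _ _ _ L N (EFin \o h))//.
  by apply: (@bounded_integrable _ _ _ (L \x N)%E h 1).
have iv : N.-integrable setT (EFin \o v) by exact: (bounded_integrable _ _ v1).
have iu : L.-integrable setT (EFin \o u) by exact: (bounded_integrable _ _ u1).
have Zu : \int[P]_w u (Z w) = \int[L]_x u x.
  congr fine; rewrite -(@integral_pushforward _ _ _ _ _ _ mZ P setT (EFin \o u))//.
    exact/measurable_EFinP.
  by rewrite preimage_setT; apply: (@bounded_integrable _ _ _ P (u \o Z) 1);
    [exact: measurableT_comp|move=> w; exact: u1].
have Yv : \int[P]_w v (Y w) = \int[N]_y v y.
  congr fine; rewrite -(@integral_pushforward _ _ _ _ _ _ mY P setT (EFin \o v))//.
    exact/measurable_EFinP.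
  by rewrite preimage_setT; apply: (@bounded_integrable _ _ _ P (v \o Y) 1);
    [exact: measurableT_comp|move=> w; exact: v1].
rewrite Zu Yv /Rintegral -[LHS]/(fine (\int[P]_w (h (Z w, Y w))%:E)) E1 E2.
have -> : (\int[L]_x \int[N]_y (u x * v y)%:E =
    \int[L]_x ((u x)%:E * \int[N]_y (v y)%:E))%E.
  apply: eq_integral => x _; under eq_integral do rewrite EFinM.
  by rewrite integralZl.
have fv : (\int[N]_y (v y)%:E)%E \is a fin_num by exact: integrable_fin_num.
rewrite -[(\int[N]_y (v y)%:E)%E]fineK// integralZr//= fineM//.
exact: integrable_fin_num.
Qed.

Lemma cintegral_indepM (a : E0 -> R[i]) (b : E -> R[i]) :
  measurable_fun setT a -> measurable_fun setT b ->
  (forall x, `|a x| <= 1) -> (forall y, `|b y| <= 1) ->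
  cintegral P (fun w => a (Z w) * b (Y w)) =
  cintegral P (fun w => a (Z w)) * cintegral P (fun w => b (Y w)).
Proof.
move=> ma mb a1 b1.
have [ra ia] := (measurable_fun_Re ma, measurable_fun_Im ma).
have [rb ib] := (measurable_fun_Re mb, measurable_fun_Im mb).
have le1 (z : R[i]) : `|z| <= 1 -> `|complex.Re z| <= 1 /\ `|complex.Im z| <= 1.
  by move=> z1; split; [apply: normc_Re_le|apply: normc_Im_le]; rewrite rmorph1.
have [ra1 ia1] : (forall x, `|complex.Re (a x)| <= 1) /\
    (forall x, `|complex.Im (a x)| <= 1).
  by split => x; have [] := le1 _ (a1 x).
have [rb1 ib1] : (forall x, `|complex.Re (b x)| <= 1) /\
    (forall x, `|complex.Im (b x)| <= 1).
  by split => x; have [] := le1 _ (b1 x).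
have int (u : E0 -> R) (v : E -> R) :
    measurable_fun setT u -> measurable_fun setT v ->
    (forall x, `|u x| <= 1) -> (forall y, `|v y| <= 1) ->
    P.-integrable setT (EFin \o (fun w => u (Z w) * v (Y w))).
  move=> mu mv u1 v1; apply: (@bounded_integrable _ _ _ P _ 1).
    by apply: measurable_funM; apply: measurableT_comp.
  by move=> w; rewrite normrM mulr_ile1.
apply/eqP; rewrite eq_complex Re_mulc Im_mulc /=.
rewrite -(Rintegral_indepM ra rb)// -(Rintegral_indepM ia ib)//.
rewrite -(Rintegral_indepM ra ib)// -(Rintegral_indepM ia rb)//.
apply/andP; split; apply/eqP.
  under eq_Rintegral do rewrite Re_mulc.
  by rewrite RintegralB//; [exact: (int _ _ ra rb)|exact: (int _ _ ia ib)].
under eq_Rintegral do rewrite Im_mulc.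
by rewrite RintegralD//; [exact: (int _ _ ra ib)|exact: (int _ _ ia rb)].
Qed.

End independent_product.

(** * The generating functional of the point process *)

Section disc_extension.
Variable R : realType.

(** The value 0 outside the disc makes a function that is measurable on the disc
    measurable everywhere. *)
Definition disc_ext (f : R[i] -> R[i]) (z : R[i]) : R[i] :=
  if `|z| <= 1 then f z else 0.

Lemma measurable_disc_ext (f : R[i] -> R[i]) :
  measurable_fun (closed_disc R) f -> measurable_fun setT (disc_ext f).
Proof.
move=> mf _ A mA; rewrite setTI.
have [A0|nA0] := pselect (A 0).
  rewrite (_ : _ @^-1` _ = (closed_disc R `&` f @^-1` A) `|` ~` closed_disc R).
    apply: measurableU; first by apply: mf => //; exact: measurable_closed_disc.
    by apply: measurableC; exact: measurable_closed_disc.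
  apply/seteqP; split => z; rewrite /disc_ext /closed_disc /=.
    by case: ifPn => [z1 fz|z1 _]; [left|right; exact/negP].
  by case=> [[-> //]|/negP/negbTE ->].
rewrite (_ : _ @^-1` _ = closed_disc R `&` f @^-1` A).
  by apply: mf => //; exact: measurable_closed_disc.
apply/seteqP; split => z; rewrite /disc_ext /closed_disc /=.
  by case: ifPn => // z1 fz.
by case=> ->.
Qed.

Lemma disc_ext_le1 (f : R[i] -> R[i]) : {homo f : z / closed_disc R z} ->
  forall z, `|disc_ext f z| <= 1.
Proof.
by move=> hf z; rewrite /disc_ext; case: ifP => [z1|_]; [exact: hf|rewrite normr0].
Qed.

(** [disc_ext id] fixes the products of interest, which lie in the disc, and
    makes the transition z -> z * F x bounded on the whole plane. *)
Lemma measurable_clip : measurable_fun setT (disc_ext id).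
Proof. by apply: measurable_disc_ext; exact: measurable_id. Qed.

Lemma clip_le1 z : `|disc_ext id z| <= 1.
Proof. by apply: disc_ext_le1. Qed.

Lemma clip_id z : `|z| <= 1 -> disc_ext id z = z.
Proof. by rewrite /disc_ext => ->. Qed.

End disc_extension.

Section point_process_generating_function.
Context d (O : measurableType d) (R : realType) (P : probability O R).
Variables (n : nat) (alpha : R).
Hypotheses (alpha0 : 0 < alpha) (alpha1 : alpha < 1).
Variable nu : probability (n.-tuple R[i]) R.
Variables (T : {RV P >-> nat}) (xi : nat -> {RV P >-> n.-tuple R[i]}).
Hypothesis hxi : is_point_process alpha (1 / 2) nu T xi.
Variable F : n.-tuple R[i] -> R[i].
Hypotheses (mF : measurable_fun setT F) (F1 : forall z, `|F z| <= 1).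

Let c := cintegral nu F.

Let Fam : set (set O) := g_sigma_algebra_preimage T.

Let FamT : Fam setT.
Proof. by exists setT => //; rewrite setTI preimage_setT. Qed.

Let mFam D : Fam D -> measurable D.
Proof. by move=> [A mA <-]; exact: measurable_funPT. Qed.

Let indep (D : set O) (K : seq nat) (B : nat -> set (n.-tuple R[i])) :
  Fam D -> uniq K -> (forall k, measurable (B k)) ->
  P (D `&` \bigcap_(k in [set` K]) (xi k @^-1` B k)) =
    (P D * \prod_(k <- K) P (xi k @^-1` B k))%E.
Proof.
move=> FD uK mB; have [_ _ hind] := hxi.
pose A (i : option nat) := if i is Some b then xi b @^-1` B b else D.
have := hind (None :: map Some K) A.
rewrite big_cons big_map /= => <-.
- congr (P _); apply/seteqP; split => w /=.
    move=> [Dw h] [b|] bK //=.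
    by apply: h; move: bK; rewrite /= inE /= (mem_map (@Some_inj _)).
  move=> h; split; first by have := h None (mem_head _ _).
  move=> k kK; have := h (Some k); apply.
  by rewrite /= inE /= (mem_map (@Some_inj _)).
- rewrite (map_inj_uniq (@Some_inj _)) uK andbT.
  by apply/mapP => -[].
- by move=> [b|] _ //=; exists (B b); [exact: mB|rewrite setTI].
Qed.

Let op (_ : nat) (z : R[i]) (x : n.-tuple R[i]) := disc_ext id z * F x.

Let mop i : measurable_fun setT (fun z : R[i] * n.-tuple R[i] => op i z.1 z.2).
Proof.
apply: measurable_fun_complexM; apply: measurableT_comp => //.
exact: measurable_clip.
Qed.

Let prodF (J : seq nat) (w : O) := \prod_(b <- J) F (xi b w).

Let prodF_le1 J w : `|prodF J w| <= 1.
Proof.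
rewrite normr_prod; elim: J => [|j J IH]; first by rewrite big_nil.
by rewrite big_cons mulr_ile1// prodr_ge0.
Qed.

Let foldE J : fold_rv xi op 1 J = prodF J.
Proof.
apply/funext => w; elim: J => [|j J IH]; first by rewrite /prodF big_nil.
rewrite /= /fold_rv /= -/(fold_rv xi op 1 J w) IH /op clip_id//.
by rewrite /prodF big_cons mulrC.
Qed.

Let m_prodF J : measurable_fun setT (prodF J).
Proof. by rewrite -foldE; exact: measurable_fold_rv. Qed.

Let cF b : cintegral P (fun w => F (xi b w)) = c.
Proof.
have [_ hlaw _] := hxi.
rewrite -(@cintegral_distribution _ _ _ _ _ P (xi b) F)//; last first.
  apply: (@cbounded_integrable _ _ _ _ _ 1).
    exact: measurableT_comp.
  by move=> w /=; rewrite rmorph1.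
by congr (_ +i* _)%C; congr fine; apply: eq_measure_integral => A mA _; exact: hlaw.
Qed.

Let cintegral_prodF J : uniq J -> cintegral P (prodF J) = c ^+ size J.
Proof.
elim: J => [_|j J IH /= /andP[jJ uJ]].
  rewrite expr0 (_ : prodF [::] = fun=> 1) ?cintegral_cst//.
  by apply/funext => w; rewrite /prodF big_nil.
have -> : prodF (j :: J) = fun w => disc_ext id (prodF J w) * F (xi j w).
  by apply/funext => w; rewrite clip_id// /prodF big_cons mulrC.
rewrite (@cintegral_indepM _ _ _ _ _ _ _ P (prodF J) (xi j) _ _ _
  (disc_ext id) F)//.
- rewrite cF exprSr -IH//; congr (cintegral _ _ * _).
  by apply/funext => w; rewrite clip_id.
- move=> A B mA mB.
  have := @independent_fold _ _ _ _ _ _ _ P _ xi Fam FamT mFam indep op 1 mop J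
    setT [:: j] A (fun=> B) FamT _ mA (fun=> mB).
  rewrite setTI probability_setT mul1e foldE big_seq1.
  rewrite set_cons1 bigcap_set1; apply.
  by rewrite cat_uniq uJ /= orbF jJ.
- exact: measurable_clip.
- exact: clip_le1.
Qed.
Let is_val (t s : nat) : R[i] := if s == t then 1 else 0.

Let measurable_is_val t : measurable_fun setT (is_val t).
Proof. by move=> _ A mA. Qed.

Let cintegral_is_val t : cintegral P (fun w => is_val t (T w)) =
  (negative_binomial_pmf alpha (1 / 2) t)%:C%C.
Proof.
have [hT _ _] := hxi.
have mTt : measurable (T @^-1` [set t]) by apply: measurable_funPTI.
congr (_ +i* _)%C; last first.
  rewrite (@eq_Rintegral _ _ _ P setT (fun=> 0)); first by rewrite Rintegral_cst// mul0r.
  by move=> w _; rewrite /is_val; case: ifP.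
rewrite (@eq_Rintegral _ _ _ P setT (\1_(T @^-1` [set t]))).
  by rewrite /Rintegral integral_indic// setIT [X in fine X](hT t).
move=> w _; rewrite /is_val indicE; case: eqVneq => [Tt|Tt].
  by rewrite mem_set.
by rewrite memNset// => h; move: Tt; rewrite h eqxx.
Qed.

Let cintegral_slice t :
  cintegral P (fun w => is_val t (T w) * prodF (iota 0 t) w) =
  (negative_binomial_pmf alpha (1 / 2) t)%:C%C * c ^+ t.
Proof.
have := @cintegral_indepM _ _ _ _ _ _ _ P T (prodF (iota 0 t)) _ _ _
  (is_val t) (disc_ext id) (measurable_is_val t) (@measurable_clip R).
have -> : (fun w => disc_ext id (prodF (iota 0 t) w)) = prodF (iota 0 t).
  by apply/funext => w; rewrite clip_id.
rewrite cintegral_is_val cintegral_prodF ?iota_uniq// size_iota => <-//.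
- congr cintegral; apply/funext => w; rewrite clip_id//.
- move=> A B mA mB.
  have := @independent_fold _ _ _ _ _ _ _ P _ xi Fam FamT mFam indep op 1 mop
    (iota 0 t) (T @^-1` A) [::] B (fun=> setT) _ _ mB (fun=> measurableT).
  rewrite foldE set_nil bigcap_set0 setIT big_nil mule1; apply.
    by exists A => //; rewrite setTI.
  by rewrite cats0 iota_uniq.
- by move=> s; rewrite /is_val; case: ifP; rewrite ?normr1 ?normr0.
- exact: clip_le1.
Qed.

Let X (w : O) := \prod_(b < T w) F (xi b w).

Let XE w : X w = prodF (iota 0 (T w)) w.
Proof.
rewrite /X -(big_mkord xpredT (fun b => F (xi b w))) /index_iota subn0//.
Qed.

Let XN N w := \sum_(t < N) is_val t (T w) * prodF (iota 0 t) w.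

Let XNE N w : XN N w = if (T w < N)%N then X w else 0.
Proof.
rewrite /XN; case: ltnP => TN.
  rewrite (bigD1 (Ordinal TN)) //= {1}/is_val eqxx mul1r XE big1 ?addr0// => i iT.
  rewrite /is_val; case: eqVneq => [Ti|_]; last by rewrite mul0r.
  by case/eqP: iT; apply: val_inj.
rewrite big1// => i _; rewrite /is_val; case: eqVneq => [Ti|_]; last by rewrite mul0r.
by have := ltn_ord i; rewrite -Ti ltnNge TN.
Qed.

Let X_le1 w : `|X w| <= 1. Proof. by rewrite XE. Qed.

Let XN_le1 N w : `|XN N w| <= 1.
Proof. by rewrite XNE; case: ifP; rewrite ?normr0. Qed.

Let m_slice t : measurable_fun setT (fun w => is_val t (T w) * prodF (iota 0 t) w).
Proof. by apply: measurable_fun_complexM => //; apply: measurableT_comp. Qed.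

Let m_XN N : measurable_fun setT (XN N).
Proof. by apply: measurable_fun_complex_sum => t; exact: m_slice. Qed.

Let XN_cvg w : ccvg (XN ^~ w) (X w).
Proof.
have E : \forall N \near \oo, XN N w = X w.
  by exists (T w).+1 => // N /= TN; rewrite XNE TN.
by split; apply: cvg_near_cst; apply: filterS E => N ->.
Qed.

Let m_X : measurable_fun setT X.
Proof.
apply: measurable_fun_complexP.
  apply: (measurable_fun_cvg (h := fun N w => complex.Re (XN N w))).
    by move=> N; exact: measurable_fun_Re.
  by move=> w _; have [] := XN_cvg w.
apply: (measurable_fun_cvg (h := fun N w => complex.Im (XN N w))).
  by move=> N; exact: measurable_fun_Im.
by move=> w _; have [] := XN_cvg w.
Qed.

Let cintegral_XN N : cintegral P (XN N) =
  \sum_(t < N) (negative_binomial_pmf alpha (1 / 2) t)%:C%C * c ^+ t.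
Proof.
have int (f : O -> R[i]) : measurable_fun setT f -> (forall w, `|f w| <= 1) ->
    cintegrable P f.
  by move=> mf f1; apply: (cbounded_integrable _ (K := 1)) => //; rewrite rmorph1.
elim: N => [|N IH].
  rewrite big_ord0 (_ : XN 0 = fun=> 0) ?cintegral_cst//.
  by apply/funext => w; rewrite /XN big_ord0.
rewrite big_ord_recr /= -IH -cintegral_slice -cintegralD; first last.
- apply: int => // w; rewrite normrM mulr_ile1//.
  by rewrite /is_val; case: ifP; rewrite ?normr1 ?normr0.
- exact: int.
by congr cintegral; apply/funext => w; rewrite /XN big_ord_recr.
Qed.

Let c_le1 : `|c| <= 1. Proof. exact: cintegral_le1. Qed.

(** The truncations of the product to T < N have mean the partial sums of the
    binomial series, and converge boundedly to the product. *)
Lemma point_process_pgf : cintegral P X =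
  (sqrtc (1 + (alpha / (1 - alpha))%:C%C * (1 - c)))^-1.
Proof.
pose s := (1 - alpha) `^ (1 / 2).
have a1 : 0 < 1 - alpha by rewrite subr_gt0.
have s0 : 0 < s by exact: powR_gt0.
have s2 : s ^+ 2 = 1 - alpha.
  by rewrite -powR_mulrn ?ltW// -powRrM mulrC mulrA mulr1 mulfV// powRr1 ?ltW.
have sC : s%:C%C != 0 by rewrite eq_complex /= negb_and gt_eqF.
set E := cintegral P X.
have EN : ccvg (fun N => cintegral P (XN N)) E.
  by apply: ccvg_cintegral.
have hs N : cintegral P (XN N) = s%:C%C * half_sum (alpha%:C%C * c) N.
  rewrite cintegral_XN /half_sum mulr_sumr; apply: eq_bigr => t _.
  rewrite /negative_binomial_pmf -/s -/(half_coef R t) exprMn !rmorphM rmorphXn /=.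
  by ring.
have z1 : `|alpha%:C%C * c| < 1.
  rewrite normrM normc_real ?ltW//.
  apply: (@le_lt_trans _ _ alpha%:C%C); first by rewrite ler_piMr// ler0c ltW.
  by rewrite -(rmorph1 (real_complex R)) ltcR.
have : ccvg (half_sum (alpha%:C%C * c)) (s%:C%C^-1 * E).
  have -> : half_sum (alpha%:C%C * c) = fun N => s%:C%C^-1 * cintegral P (XN N).
    by apply/funext => N; rewrite hs mulrA mulVf// mul1r.
  by apply: ccvgM => //; exact: ccvg_cst.
move/(half_series_limit z1) => h.
have -> : E = s%:C%C * (sqrtc (1 - alpha%:C%C * c))^-1.
  by rewrite -h mulrA mulfV// mul1r.
have aC : (1 - alpha)%:C%C != 0 by rewrite eq_complex /= negb_and gt_eqF.
have -> : 1 + (alpha / (1 - alpha))%:C%C * (1 - c) =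
    ((1 - alpha)^-1)%:C%C * (1 - alpha%:C%C * c).
  move: aC; rewrite rmorphM !fmorphV rmorphB rmorph1 /= => aC.
  by field.
rewrite sqrtcZ ?invr_gt0// invfM; congr (_ * _).
rewrite sqrtrV ?ltW// -s2 sqrtr_sqr gtr0_norm// fmorphV invrK//.
Qed.

End point_process_generating_function.

Section polydisc.
Variables (R : realType) (n : nat).

Definition polydisc : set (n.-tuple R[i]) :=
  [set z | forall k, closed_disc R (tnth z k)].

Lemma measurable_polydisc : measurable polydisc.
Proof.
rewrite (_ : polydisc = \bigcap_(k in [set: 'I_n])
    ((fun z : n.-tuple R[i] => tnth z k) @^-1` closed_disc R)).
  apply: fin_bigcap_measurable => // k _; rewrite -[X in measurable X]setTI.
  by apply: measurable_tnth => //; exact: measurable_closed_disc.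
by apply/seteqP; split => z h k //=; exact: h.
Qed.

End polydisc.
Arguments polydisc : clear implicits.

Section generating_functional.
Context d (O : measurableType d) (R : realType) (P : probability O R).
Variables (n : nat) (alpha : R).
Hypotheses (alpha0 : 0 < alpha) (alpha1 : alpha < 1).
Variable nu : probability (n.-tuple R[i]) R.
Hypothesis nu_polydisc : nu (~` polydisc R n) = 0%E.
Variables (T : {RV P >-> nat}) (xi : nat -> {RV P >-> n.-tuple R[i]}).
Hypothesis hxi : is_point_process alpha (1 / 2) nu T xi.
Variable f : 'I_n -> R[i] -> R[i].
Hypothesis mf : forall k, measurable_fun (closed_disc R) (f k).
Hypothesis f_disc : forall k, {homo f k : z / closed_disc R z}.

Let F (z : n.-tuple R[i]) := \prod_(k < n) disc_ext (f k) (tnth z k).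

Let mF : measurable_fun setT F.
Proof.
apply: measurable_fun_complex_prod => k.
apply: measurableT_comp; first exact: measurable_disc_ext.
exact: measurable_tnth.
Qed.

Let F1 z : `|F z| <= 1.
Proof.
rewrite normr_prod; apply: prodr_ile1 => k _.
by rewrite normr_ge0 disc_ext_le1.
Qed.

Let FE z : polydisc R n z -> F z = \prod_(k < n) f k (tnth z k).
Proof.
move=> hz; apply: eq_bigr => k _.
by rewrite /disc_ext; have := hz k; rewrite /closed_disc /= => ->.
Qed.

Lemma cintegral_prod_disc :
  cintegral nu (fun z => \prod_(k < n) f k (tnth z k)) = cintegral nu F.
Proof.
apply: (cintegral_null_eq (N := ~` polydisc R n)) => //.
  by apply: measurableC; exact: measurable_polydisc.
by move=> z /contrapT hz; rewrite FE.
Qed.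

Lemma cintegral_prod_disc_le1 :
  `|cintegral nu (fun z => \prod_(k < n) f k (tnth z k))| <= 1.
Proof. by rewrite cintegral_prod_disc; exact: cintegral_le1. Qed.

Lemma cintegral_one_sub_prod_disc :
  cintegral nu (fun z => 1 - \prod_(k < n) f k (tnth z k)) =
  1 - cintegral nu (fun z => \prod_(k < n) f k (tnth z k)).
Proof.
rewrite cintegral_prod_disc.
rewrite (@cintegral_null_eq _ _ _ nu (~` polydisc R n) _ nu_polydisc _
  (fun z => 1 + -1 * F z)); first last.
- by move=> z /contrapT hz; rewrite FE// mulN1r.
- by apply: measurableC; exact: measurable_polydisc.
have iF : cintegrable nu F.
  by apply: (cbounded_integrable _ (K := 1)) => // z; rewrite rmorph1.
rewrite cintegralD ?cintegral_cst ?cintegralZ ?mulN1r//; last exact: cintegrableZ.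
by apply: (cbounded_integrable _ (K := 1)) => // z; rewrite normr1 rmorph1.
Qed.

(** The functions f_k are replaced by 0 outside the disc; this changes the
    product only when some point leaves the polydisc, which has probability 0. *)
Lemma generating_functional :
  cexpectation P (fun w =>
    \prod_(b < T w) \prod_(k < n) f k (tnth (xi b w) k)) =
  (sqrtc (1 + (alpha / (1 - alpha))%:C%C *
    cintegral nu (fun z => 1 - \prod_(k < n) f k (tnth z k))))^-1.
Proof.
rewrite cintegral_one_sub_prod_disc cintegral_prod_disc.
rewrite -(point_process_pgf alpha0 alpha1 hxi mF F1).
pose N := \bigcup_b (xi b @^-1` (~` polydisc R n)).
have mC : measurable (~` polydisc R n).
  by apply: measurableC; exact: measurable_polydisc.
have mN : measurable N.
  by apply: bigcup_measurable => b _; apply: measurable_funPTI.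
apply: (cintegral_null_eq (N := N)) => //.
  apply: measure_negligible => //; apply: negligible_bigcup => b.
  apply/negligibleP; first by apply: measurable_funPTI.
  by have [_ hlaw _] := hxi; have := hlaw b _ mC; rewrite nu_polydisc.
move=> w nN; apply: eq_bigr => b _; rewrite FE//; apply: contrapT => h.
by apply: nN; exists b.
Qed.

End generating_functional.

Section de_finetti_support.
Variables (R : realType) (q : nat).

Lemma normc_theta k m : `|theta R q k ^+ m| = 1.
Proof.
by rewrite normrX -[`|theta R q k|]/(Num.sqrt _)%:C%C cos2Dsin2 sqrtr1 expr1n.
Qed.

Lemma xi_of_polydisc p : distributions R q p -> polydisc R q.-1 (xi_of p).
Proof.
move=> [p0 p1] k; rewrite /closed_disc /= tnth_mktuple.
apply: le_trans (ler_norm_sum _ _ _) _.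
rewrite -(rmorph1 (real_complex R)) -p1 rmorph_sum /=; apply: ler_sum => j _.
by rewrite normrM normc_theta mul1r normc_real.
Qed.

Lemma measurable_distributions : measurable (distributions R q).
Proof.
rewrite (_ : distributions R q = \bigcap_(j in [set: 'I_q])
    ((fun p : q.-tuple R => tnth p j) @^-1` `[0, +oo[%classic) `&`
    (fun p : q.-tuple R => \sum_(j < q) tnth p j) @^-1` [set 1]).
  apply: measurableI.
    apply: fin_bigcap_measurable => // j _; rewrite -[X in measurable X]setTI.
    exact: measurable_tnth.
  rewrite -[X in measurable X]setTI.
  by apply: measurable_sum => // j; exact: measurable_tnth.
apply/seteqP; split => p /=.
  by move=> [h1 h2]; split => // j _ /=; rewrite in_itv /= h1.
by move=> [h1 h2]; split => // j; have := h1 j I; rewrite /= in_itv /= andbT.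
Qed.

Lemma nu_polydisc (mu : probability (q.-tuple R) R) :
  mu (distributions R q) = 1%E -> nu mu (~` polydisc R q.-1) = 0%E.
Proof.
move=> mu1; apply/eqP; rewrite eq_le measure_ge0 andbT.
have <- : mu (~` distributions R q) = 0%E.
  by rewrite probability_setC ?mu1 ?subee//; exact: measurable_distributions.
apply: (@le_measure _ _ _ mu (@xi_of R q @^-1` (~` polydisc R q.-1))); rewrite ?inE.
- apply: measurable_funPTI; apply: measurableC; exact: measurable_polydisc.
- by apply: measurableC; exact: measurable_distributions.
by move=> p; apply: contra_not; exact: xi_of_polydisc.
Qed.

End de_finetti_support.

(** * Normal laws *)

Section density.
Context d (T : measurableType d) (R : realType).
Variables (m nu : {measure set T -> \bar R}) (g : T -> R).
Hypotheses (mg : measurable_fun setT g) (g0 : forall x, 0 <= g x).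
Hypothesis nuE : forall A, measurable A -> nu A = (\int[m]_(x in A) (g x)%:E)%E.
Local Open Scope ereal_scope.
Import HBNNSimple.

Let ge0_integral_density_nnsfun (h : {nnsfun T >-> R}) :
  \int[nu]_x (h x)%:E = \int[m]_x ((h x)%:E * (g x)%:E).
Proof.
have mh r : measurable (h @^-1` [set r]) by exact: measurable_funPTI.
rewrite integralT_nnsfun sintegralE.
have -> : \int[m]_x ((h x)%:E * (g x)%:E) =
    \int[m]_x \sum_(r \in range h) (r * \1_(h @^-1` [set r]) x * g x)%:E.
  apply: eq_integral => x _; rewrite {1}fimfunE -fsumEFin//.
  by rewrite ge0_mule_fsuml// => r; rewrite EFinM nnfun_muleindic_ge0.
rewrite ge0_integral_fsum//; last 2 first.
- move=> r; apply/measurable_EFinP; apply: measurable_funM => //.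
  by apply: measurable_funM.
- by move=> r x _; rewrite EFinM mule_ge0 ?lee_fin// -lee_fin EFinM nnfun_muleindic_ge0.
apply: eq_fsbigr => r /[!inE] -[x _ hx].
have r0 : (0 <= r)%R by rewrite -hx.
rewrite nuE// integral_mkcond -ge0_integralZl//; last first.
- by move=> y _; rewrite patchE; case: ifP => //; rewrite lee_fin.
- apply/(measurable_restrictT _ _).1 => //.
  by apply/measurable_EFinP; exact: measurable_funTS.
apply: eq_integral => y _; rewrite patchE indicE -mulrA EFinM; congr (_ * _).
by case: ifPn => /= _; rewrite ?mul1r ?mul0r.
Qed.

Lemma ge0_integral_density (f : T -> \bar R) : measurable_fun setT f ->
  (forall x, 0 <= f x) -> \int[nu]_x f x = \int[m]_x (f x * (g x)%:E).
Proof.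
move=> mf f0; pose f_ := nnsfun_approx measurableT mf.
have f_f x : (f_ n x)%:E @[n --> \oo] --> f x.
  by apply: cvg_nnsfun_approx.
have ndf x : {homo (fun n => (f_ n x)%:E) : a b / (a <= b)%N >-> a <= b}.
  by move=> a b ab; rewrite lee_fin; exact/lefP/nd_nnsfun_approx.
transitivity (limn (fun n => \int[nu]_x (f_ n x)%:E)).
  rewrite -monotone_convergence//.
  - by apply: eq_integral => x _; apply/esym/cvg_lim.
  - by move=> n; exact/measurable_EFinP.
  - by move=> n x _; rewrite lee_fin.
transitivity (limn (fun n => \int[m]_x ((f_ n x)%:E * (g x)%:E))).
  by congr (limn _); apply/funext => n; exact: ge0_integral_density_nnsfun.
rewrite -monotone_convergence//.
- apply: eq_integral => x _; apply/cvg_lim => //.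
  under eq_fun do rewrite muleC; rewrite [f x * _]muleC.
  by apply: cvgeZl.
- move=> n; apply: emeasurable_funM; exact/measurable_EFinP.
- by move=> n x _; rewrite mule_ge0 ?lee_fin.
- by move=> x _ a b ab; rewrite lee_wpmul2r ?lee_fin//; have := ndf x _ _ ab; rewrite lee_fin.
Qed.

End density.

Section lebesgue_affine.
Variable R : realType.
Variables a b : R.
Hypothesis a0 : a != 0.
Local Notation mu := (@lebesgue_measure R).
Let phi (x : measurableTypeR R) : measurableTypeR R := a * x + b.

Let mphi : measurable_fun setT phi.
Proof. by apply: measurable_funD => //; exact: measurable_funM. Qed.

Lemma lebesgue_measure_affine (A : set R) : measurable A ->
  mu A = (`|a|%:E * mu (phi @^-1` A))%E.
Proof.
have a0' : 0 <= `|a| by [].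
pose m := mscale (NngNum a0') (pushforward mu phi).
move=> mA; rewrite (lebesgue_measure_unique (mu := m mphi))//.
move=> _ [[x y] _ <-].
suff : mu `]x, y]%classic = (`|a|%:E * mu (phi @^-1` `]x, y]%classic))%E by [].
have [ap|an] := ltP 0 a.
  have -> : phi @^-1` `]x, y]%classic = `](x - b) / a, (y - b) / a]%classic.
    apply/seteqP; split => z; rewrite /= !in_itv /= /phi.
      by rewrite ltr_pdivrMr// ler_pdivlMr// ltrBlDr lerBrDr mulrC.
    by rewrite ltr_pdivrMr// ler_pdivlMr// ltrBlDr lerBrDr mulrC.
  rewrite !lebesgue_measure_itv /= !lte_fin gtr0_norm//.
  rewrite ltr_pM2r ?invr_gt0// ltrD2r.
  case: ifP => _; last by rewrite mule0.
  by rewrite -!EFinB -EFinM -mulrBl opprB addrA subrK mulrC divfK.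
have {}an : a < 0 by rewrite lt_neqAle a0.
have -> : phi @^-1` `]x, y]%classic = `[(y - b) / a, (x - b) / a[%classic.
  apply/seteqP; split => z; rewrite /= !in_itv /= /phi.
    by rewrite ltr_ndivlMr// ler_ndivrMr// ltrBlDr lerBrDr mulrC andbC.
  by rewrite ltr_ndivlMr// ler_ndivrMr// ltrBlDr lerBrDr mulrC andbC.
rewrite !lebesgue_measure_itv /= !lte_fin ltr0_norm//.
rewrite ltr_nM2r ?invr_lt0// ltrD2r.
case: ifP => _; last by rewrite mule0.
by rewrite -!EFinB -EFinM -mulrBl opprB addrA subrK mulrC mulrN divfK// opprB.
Qed.

Lemma ge0_integral_affine (f : R -> \bar R) : measurable_fun setT f ->
  (forall x, 0 <= f x)%E ->
  (\int[mu]_x f x = `|a|%:E * \int[mu]_x f (a * x + b)%R)%E.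
Proof.
have a0' : 0 <= `|a| by [].
move=> mf f0.
pose m := mscale (NngNum a0') (pushforward mu phi).
transitivity (\int[m mphi]_x f x)%E.
  by apply: eq_measure_integral => A mA _; exact: lebesgue_measure_affine.
rewrite ge0_integral_mscale//; congr (_ * _)%E.
by rewrite (ge0_integral_pushforward mphi mu measurableT mf)// preimage_setT.
Qed.

End lebesgue_affine.

Section normal_law.
Variable R : realType.
Local Notation mu := (@lebesgue_measure R).

Lemma normal_pdf_affine (m s a b z : R) : s != 0 -> a != 0 ->
  normal_pdf m s z = `|a| * normal_pdf (a * m + b) (a * s) (a * z + b).
Proof.
move=> s0 a0; have as0 : a * s != 0 by rewrite mulf_neq0.
rewrite !normal_pdfE// mulrA; congr (_ * _).
  have -> : normal_peak (a * s) = (Num.sqrt (a ^+ 2 * (s ^+ 2 * pi *+ 2)))^-1.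
    by rewrite /normal_peak exprMn mulrnAr mulrA.
  rewrite /normal_peak sqrtrM ?sqr_ge0// sqrtr_sqr invfM.
  by rewrite mulrA divff ?normr_eq0// mul1r.
rewrite /normal_fun; congr expR.
have -> : a * z + b - (a * m + b) = a * (z - m) by ring.
by field; rewrite s0 a0.
Qed.

Lemma normal_prob_affine (m s a b : R) (A : set R) : s != 0 -> a != 0 ->
  measurable A ->
  normal_prob m s ((fun x => a * x + b) @^-1` A) = normal_prob (a * m + b) (a * s) A.
Proof.
move=> s0 a0 mA.
have mpdf k u : measurable_fun [set: R] (fun x => (normal_pdf k u x)%:E).
  by apply/measurable_EFinP; exact: measurable_normal_pdf.
have maff : measurable_fun [set: R] (fun x => a * x + b).
  by apply: measurable_funD => //; exact: measurable_funM.
pose F := (fun x => (normal_pdf (a * m + b) (a * s) x)%:E) \_ A.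
have mF : measurable_fun [set: R] F.
  by apply/(measurable_restrictT _ _).1 => //; exact: measurable_funTS (mpdf _ _).
have F0 x : (0 <= F x)%E.
  by rewrite /F patchE; case: ifP => // _; rewrite lee_fin normal_pdf_ge0.
rewrite /normal_prob integral_mkcond [RHS]integral_mkcond -/F.
rewrite (ge0_integral_affine b a0 mF F0) -ge0_integralZl//.
  apply: eq_integral => x _; rewrite /F !patchE.
  have -> : (a * x + b \in A) = (x \in (fun x => a * x + b) @^-1` A).
    by apply/idP/idP; rewrite !inE.
  by case: ifP => _; rewrite ?mule0// (normal_pdf_affine _ b _ s0 a0) EFinM.
exact: (measurableT_comp mF maff).
Qed.

(** Completing the square in x: the conditional law of x given z is normal of
    mean z s ^ 2 / sg ^ 2 and deviation s c / sg. *)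
Lemma normal_pdf_mul (s c sg x z : R) : s != 0 -> c != 0 ->
  sg ^+ 2 = s ^+ 2 + c ^+ 2 ->
  normal_pdf 0 s x * normal_pdf x c z =
  normal_pdf 0 sg z * normal_pdf (z * s ^+ 2 / sg ^+ 2) (s * c / sg) x.
Proof.
move=> s0 c0 sgE.
have sg2 : 0 < sg ^+ 2.
  by rewrite sgE ltr_pwDl ?sqr_ge0// exprn_even_gt0.
have sg0 : sg != 0 by move: sg2; rewrite lt_neqAle eq_sym sqrf_eq0 => /andP[].
have d0 : s * c / sg != 0 by rewrite !mulf_neq0// invr_neq0.
rewrite !normal_pdfE// mulrACA [RHS]mulrACA; congr (_ * _).
  rewrite /normal_peak -!invfM -!sqrtrM; first last.
  - by rewrite mulrn_wge0// mulr_ge0 ?sqr_ge0 ?pi_ge0.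
  - by rewrite mulrn_wge0// mulr_ge0 ?sqr_ge0 ?pi_ge0.
  by congr (_^-1); congr (Num.sqrt _); field.
rewrite /normal_fun -!expRD; congr expR; rewrite subr0.
have c2 : c ^+ 2 = sg ^+ 2 - s ^+ 2 by rewrite sgE addrC addKr.
have c2' : sg ^+ 2 - s ^+ 2 != 0 by rewrite -c2 sqrf_eq0.
rewrite !exprMn !exprVn c2.
by field; rewrite s0 sg0 /= c2'.
Qed.
End normal_law.

Section gaussian_law.
Variable R : realType.
Local Notation mu := (@lebesgue_measure R).

(** The centred law of standard deviation s, the point mass included. *)
Definition gaussian_law (s : R) (A : set R) : \bar R :=
  if s == 0 then \d_(0 : R) A else normal_prob 0 s A.

Lemma ge0_integral_normal_prob (m s : R) (f : R -> \bar R) :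
  measurable_fun setT f -> (forall x, 0 <= f x)%E ->
  (\int[normal_prob m s]_x f x = \int[mu]_x (f x * (normal_pdf m s x)%:E))%E.
Proof.
move=> mf f0; apply: ge0_integral_density => //.
- exact: measurable_normal_pdf.
- by move=> x; exact: normal_pdf_ge0.
Qed.

(** Lebesgue measure lives on a copy of R whose measurable structure carries
    another display, so the law L is compared with the image of the normal
    measure under the identity from this copy to R. *)
Lemma ge0_integral_normal_law (L : probability R R) (m s : R) (f : R -> \bar R) :
  (forall B, measurable B -> L B = normal_prob m s B) ->
  measurable_fun setT f -> (forall x, 0 <= f x)%E ->
  (\int[L]_x f x = \int[mu]_x (f x * (normal_pdf m s x)%:E))%E.
Proof.
move=> LE mf f0; pose j (x : measurableTypeR R) : R := x.
have mj : measurable_fun setT j by move=> _ A mA; rewrite setTI.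
rewrite -ge0_integral_normal_prob//.
have := @ge0_integral_pushforward _ _ _ _ _ j mj (normal_prob m s) setT f
  measurableT mf (fun x _ => f0 x).
rewrite preimage_setT => <-.
by apply: eq_measure_integral => A mA _; exact: LE.
Qed.

(** Convolution of centred normal laws: exchange the integrals, apply
    [normal_pdf_mul], and integrate the second density to 1. *)
Let normal_conv (s c sg : R) (A : set R) : s != 0 -> c != 0 ->
  sg ^+ 2 = s ^+ 2 + c ^+ 2 -> measurable A ->
  (\int[mu]_x (normal_prob x c A * (normal_pdf 0 s x)%:E) = normal_prob 0 sg A)%E.
Proof.
move=> s0 c0 sgE mA.
have sg2 : 0 < sg ^+ 2.
  by rewrite sgE ltr_pwDl ?sqr_ge0// exprn_even_gt0.
have sg0 : sg != 0 by move: sg2; rewrite lt_neqAle eq_sym sqrf_eq0 => /andP[].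
pose h (z : R * R) : R := normal_pdf 0 s z.1 * normal_pdf z.1 c z.2 * \1_A z.2.
have mh : measurable_fun setT (EFin \o h).
  apply/measurable_EFinP; apply: measurable_funM; last first.
    by apply: measurableT_comp.
  apply: measurable_funM.
    by apply: measurableT_comp => //; exact: measurable_normal_pdf.
  rewrite (_ : (fun z : R * R => normal_pdf z.1 c z.2) =
     normal_pdf 0 c \o (fun z : R * R => z.2 - z.1)).
    apply: measurableT_comp; first exact: measurable_normal_pdf.
    exact: measurable_funB.
  by apply/funext => z; rewrite /= !normal_pdfE// /normal_fun subr0.
have h0 z : (0 <= (EFin \o h) z)%E.
  by rewrite lee_fin !mulr_ge0 ?normal_pdf_ge0.
have := @fubini_tonelli _ _ _ _ _ mu mu (EFin \o h) mh h0.
have -> : (\int[mu]_x \int[mu]_y (EFin \o h) (x, y) =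
    \int[mu]_x (normal_prob x c A * (normal_pdf 0 s x)%:E))%E.
  apply: eq_integral => x _; rewrite /normal_prob muleC [X in (_ * X)%E]integral_mkcond.
  rewrite -ge0_integralZl//.
  - apply: eq_integral => y _; rewrite /= /h /= -mulrA EFinM; congr (_ * _)%E.
    by rewrite patchE indicE; case: ifP => _; rewrite ?mulr1 ?mulr0.
  - apply/(measurable_restrictT _ _).1 => //.
    by apply/measurable_EFinP; apply: measurable_funTS; exact: measurable_normal_pdf.
  - by move=> y _; rewrite patchE; case: ifP => // _; rewrite lee_fin normal_pdf_ge0.
  - by rewrite lee_fin normal_pdf_ge0.
move=> ->; rewrite /normal_prob [RHS]integral_mkcond.
apply: eq_integral => y _.
transitivity (\int[mu]_x ((normal_pdf 0 sg y * \1_A y)%:E *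
    (normal_pdf (y * s ^+ 2 / sg ^+ 2) (s * c / sg) x)%:E))%E.
  by apply: eq_integral => x _; rewrite /= /h /= (normal_pdf_mul _ _ s0 c0 sgE)
    -EFinM mulrAC.
rewrite ge0_integralZl//.
- rewrite integral_normal_pdf mule1 patchE indicE.
  by case: ifP => _; rewrite ?mulr1 ?mulr0.
- by apply/measurable_EFinP; exact: measurable_normal_pdf.
- by move=> x _; rewrite lee_fin normal_pdf_ge0.
- by rewrite lee_fin mulr_ge0 ?normal_pdf_ge0.
Qed.

Lemma gaussian_law_sqr (s t : R) : s ^+ 2 = t ^+ 2 -> gaussian_law s = gaussian_law t.
Proof.
move=> st; have st0 : (s == 0) = (t == 0) by rewrite -sqrf_eq0 st sqrf_eq0.
apply/funext => A; rewrite /gaussian_law st0.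
have [//|t0] := eqVneq t 0; apply: eq_integral => x _.
have s0 : s != 0 by rewrite st0.
by rewrite !normal_pdfE// /normal_peak /normal_fun st.
Qed.

(** One step of the sum: given the value x of the partial sum, x + c gamma is
    normal of mean x and deviation c, unless c = 0. *)
Lemma gaussian_law_step (L N : probability R R) (s c sg : R) (A : set R) :
  (forall B, measurable B -> L B = gaussian_law s B) ->
  (forall B, measurable B -> N B = normal_prob 0 1 B) ->
  sg ^+ 2 = s ^+ 2 + c ^+ 2 -> measurable A ->
  (L \x N)%E [set z : R * R | A (z.1 + c * z.2)] = gaussian_law sg A.
Proof.
move=> LE NE sgE mA; set C := [set z | _].
pose g (x y : R) := x + c * y.
have mg x : measurable_fun [set: R] (g x).
  by apply: measurable_funD => //; exact: measurable_funM.
have mpre x : measurable (g x @^-1` A).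
  by rewrite -[X in measurable X]setTI; exact: mg.
have mC : measurable C.
  rewrite -[X in measurable X]setTI.
  have : measurable_fun [set: R * R] (fun z => z.1 + c * z.2).
    by apply: measurable_funD => //; apply: measurable_funM => //.
  by apply.
have secE x : xsection C x = g x @^-1` A.
  by apply/seteqP; split => y; rewrite /xsection /= inE.
have -> : (L \x N)%E C = (\int[L]_x N (g x @^-1` A))%E.
  by apply: eq_integral => x _ /=; rewrite secE.
have mN : measurable_fun setT (fun x => N (g x @^-1` A)).
  have := measurable_fun_xsection N mC.
  by congr (measurable_fun _ _); apply/funext => x /=; rewrite secE.
have [c0|c0] := eqVneq c 0.
  have NA x : N (g x @^-1` A) = (\1_A x)%:E.
    have [Ax|Ax] := pselect (A x).
      rewrite indicE mem_set// (_ : _ @^-1` _ = setT) ?probability_setT//.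
      by apply/seteqP; split => // y _; rewrite /g /= c0 mul0r addr0.
    rewrite indicE memNset// (_ : _ @^-1` _ = set0) ?measure0//.
    by apply/seteqP; split => // y; rewrite /g /= c0 mul0r addr0.
  rewrite (eq_integral (fun x => (\1_A x)%:E)); last by move=> x _; rewrite NA.
  transitivity (L A); first by rewrite integral_indic// setIT.
  rewrite LE//; congr (_ A); apply: gaussian_law_sqr.
  by rewrite sgE c0 expr0n addr0.
have NA x : N (g x @^-1` A) = normal_prob x c A.
  rewrite NE// (_ : g x @^-1` A = (fun y => c * y + x) @^-1` A); last first.
    by apply/seteqP; split => y; rewrite /g /= addrC.
  by rewrite normal_prob_affine ?oner_eq0// mulr0 add0r mulr1.
have [s0|s0] := eqVneq s 0.
  transitivity (\int[\d_(0%R : R)]_x N (g x @^-1` A))%E.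
    by apply: eq_measure_integral => B mB _; have := LE B mB; rewrite /gaussian_law s0 eqxx.
  rewrite integral_dirac// diracT mul1e NA.
  rewrite (@gaussian_law_sqr sg c); first by rewrite /gaussian_law (negbTE c0).
  by rewrite sgE s0 expr0n add0r.
transitivity (\int[L]_x normal_prob x c A)%E.
  by apply: eq_integral => x _; rewrite NA.
rewrite (@ge0_integral_normal_law _ 0 s)//; first last.
- by move: mN; congr (measurable_fun _ _); apply/funext => x; rewrite NA.
- by move=> B mB; rewrite LE// /gaussian_law (negbTE s0).
rewrite (normal_conv s0 c0 sgE mA) /gaussian_law ifF//.
by apply/negbTE; rewrite -sqrf_eq0 sgE gt_eqF// ltr_pwDl ?sqr_ge0// exprn_even_gt0.
Qed.


(** Let M be the second moment. Comparing the densities of deviations s and u s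
    by exp t >= 1 + t and integrating yields u >= 1 + (1 - u ^ -2) M / (2 s ^ 2)
    for all u > 0. For u > 1 this is an upper bound of M, which also proves that
    M is finite, and for u < 1 a lower bound; both tend to s ^ 2. *)
Lemma gaussian_second_moment (s : R) : s != 0 ->
  (\int[mu]_x ((x ^+ 2)%:E * (normal_pdf 0 s x)%:E) = (s ^+ 2)%:E)%E.
Proof.
move=> s0.
have s2 : 0 < s ^+ 2 by rewrite exprn_even_gt0.
have mX2 : measurable_fun [set: R] (fun x => (x ^+ 2)%:E).
  by apply/measurable_EFinP; exact: measurable_funX.
set M := (\int[mu]_x _)%E.
have mp u : measurable_fun [set: R] (fun x => (normal_pdf 0 u x)%:E).
  by apply/measurable_EFinP; exact: measurable_normal_pdf.
have mM : measurable_fun [set: R] (fun x => ((x ^+ 2)%:E * (normal_pdf 0 s x)%:E)%E).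
  exact: emeasurable_funM.
have M0 x : (0 <= (x ^+ 2)%:E * (normal_pdf 0 s x)%:E)%E.
  by rewrite -EFinM lee_fin mulr_ge0 ?sqr_ge0// normal_pdf_ge0.
have key u x : 0 < u -> normal_pdf 0 s x * (1 + (1 - u ^- 2) * x ^+ 2 / (s ^+ 2 *+ 2))
    <= u * normal_pdf 0 (u * s) x.
  move=> u0; have us0 : u * s != 0 by rewrite mulf_neq0// gt_eqF.
  have -> : u * normal_pdf 0 (u * s) x = normal_pdf 0 s (u^-1 * x).
    rewrite [RHS](normal_pdf_affine _ 0 _ s0 (lt0r_neq0 u0)) gtr0_norm//.
    by rewrite mulr0 !addr0 mulrA mulfV ?gt_eqF// mul1r.
  rewrite !normal_pdfE// -[leLHS]mulrA ler_wpM2l ?normal_peak_ge0//.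
  rewrite /normal_fun !subr0.
  have -> : - (u^-1 * x) ^+ 2 / (s ^+ 2 *+ 2) = - x ^+ 2 / (s ^+ 2 *+ 2) +
      (1 - u ^- 2) * x ^+ 2 / (s ^+ 2 *+ 2).
    by field; rewrite s0 gt_eqF.
  by rewrite expRD ler_wpM2l ?expR_ge0// expR_ge1Dx.
have p0 u x : (0 <= (normal_pdf 0 u x)%:E)%E by rewrite lee_fin normal_pdf_ge0.
have mZ k (f : R -> \bar R) : measurable_fun [set: R] f ->
    measurable_fun [set: R] (fun x => k%:E * f x)%E.
  by move=> mf; exact: emeasurable_funM.
have kM0 k x : 0 <= k -> (0 <= k%:E * ((x ^+ 2)%:E * (normal_pdf 0 s x)%:E))%E.
  by move=> k0; rewrite mule_ge0.
have kp0 k u x : 0 <= k -> (0 <= k%:E * (normal_pdf 0 u x)%:E)%E.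
  by move=> k0; rewrite mule_ge0.
have intM k : 0 <= k ->
    (\int[mu]_x (k%:E * ((x ^+ 2)%:E * (normal_pdf 0 s x)%:E)) = k%:E * M)%E.
  by move=> k0; rewrite ge0_integralZl.
have intp k u : 0 <= k -> (\int[mu]_x (k%:E * (normal_pdf 0 u x)%:E) = k%:E)%E.
  move=> k0; rewrite ge0_integralZl//; last exact: mp.
  by rewrite integral_normal_pdf mule1.
(* The bound 2 s ^ 2 u ^ 2 / (u + 1) obtained for M is relaxed to s ^ 2 u ^ 2. *)
have upper u : 1 < u -> (M <= (s ^+ 2 * u ^+ 2)%:E)%E.
  move=> u1; have u0 : 0 < u by rewrite (lt_trans _ u1).
  pose k := (1 - u ^- 2) / (s ^+ 2 *+ 2).
  have k0 : 0 < k.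
    by rewrite divr_gt0 ?mulrn_wgt0// subr_gt0 invf_lt1 ?exprn_gt0// exprn_egt1.
  have : (1%:E + k%:E * M <= u%:E)%E.
    rewrite -(intp _ s ler01) -(intM _ (ltW k0)) -(intp _ (u * s) (ltW u0)).
    rewrite -ge0_integralD//; last 4 first.
    - by move=> x _; exact: kp0.
    - exact: mZ.
    - by move=> x _; apply: kM0; exact: ltW.
    - exact: mZ.
    apply: ge0_le_integral => //.
    - by move=> x _; rewrite adde_ge0 ?kp0// kM0// ltW.
    - by apply: emeasurable_funD; exact: mZ.
    - exact: mZ.
    move=> x _; rewrite -!EFinM -EFinD lee_fin; apply: le_trans (key u x u0).
    by rewrite /k le_eqVlt; apply/orP; left; apply/eqP; ring.
  move=> h; have : (k%:E * M <= (u - 1)%:E)%E by rewrite EFinB leeBrDl.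
  rewrite -lee_pdivlMl// => /le_trans; apply; rewrite -EFinM lee_fin.
  have -> : k^-1 * (u - 1) = s ^+ 2 * (2 * u ^+ 2 / (u + 1)).
    have u1' : u - 1 != 0 by rewrite subr_eq0 gt_eqF.
    have u2 : u + 1 != 0 by rewrite gt_eqF// addr_gt0.
    have -> : k = (u - 1) * (u + 1) / (2 * s ^+ 2 * u ^+ 2).
      by rewrite /k; field; rewrite s0 gt_eqF.
    by field; rewrite s0 u1' u2 gt_eqF.
  have u2 : 0 < u + 1 by rewrite addr_gt0.
  rewrite ler_wpM2l ?sqr_ge0// ler_pdivrMr// mulrC ler_wpM2l ?sqr_ge0//.
  lra.
have lower u : 0 < u -> u < 1 -> ((s ^+ 2 * u ^+ 2)%:E <= M)%E.
  move=> u0 u1; pose k := (u ^- 2 - 1) / (s ^+ 2 *+ 2).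
  have k0 : 0 < k.
    rewrite divr_gt0 ?mulrn_wgt0// subr_gt0 invf_gt1 ?exprn_gt0//.
    by rewrite exprn_ilt1// ltW.
  have : (1%:E <= u%:E + k%:E * M)%E.
    rewrite -(intp _ s ler01) -(intM _ (ltW k0)) -(intp _ (u * s) (ltW u0)).
    rewrite -ge0_integralD//; last 4 first.
    - by move=> x _; apply: kp0; exact: ltW.
    - exact: mZ.
    - by move=> x _; apply: kM0; exact: ltW.
    - exact: mZ.
    apply: ge0_le_integral => //.
    - by move=> x _; exact: kp0.
    - exact: mZ.
    - by apply: emeasurable_funD; exact: mZ.
    move=> x _; rewrite -!EFinM -EFinD lee_fin -lerBlDr; apply: le_trans (key u x u0).
    by rewrite /k le_eqVlt; apply/orP; left; apply/eqP; ring.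
  move=> h; have : ((1 - u)%:E <= k%:E * M)%E by rewrite EFinB leeBlDl.
  rewrite -lee_pdivrMl//; apply: le_trans; rewrite -EFinM lee_fin.
  have -> : k^-1 * (1 - u) = s ^+ 2 * (2 * u ^+ 2 / (u + 1)).
    have u1' : 1 - u != 0 by rewrite subr_eq0 gt_eqF.
    have u2 : u + 1 != 0 by rewrite gt_eqF// addr_gt0.
    have -> : k = (1 - u) * (u + 1) / (2 * s ^+ 2 * u ^+ 2).
      by rewrite /k; field; rewrite s0 gt_eqF.
    by field; rewrite s0 u1' u2 gt_eqF.
  have u2 : 0 < u + 1 by rewrite addr_gt0.
  rewrite ler_wpM2l ?sqr_ge0// ler_pdivlMr// mulrC -subr_ge0.
  rewrite (_ : _ - _ = u ^+ 2 * (1 - u)); last by ring.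
  by rewrite mulr_ge0 ?sqr_ge0// subr_ge0 ltW.
apply/eqP; rewrite eq_le; apply/andP; split.
  apply/lee_addgt0Pr => e e0.
  pose u := Num.sqrt (1 + e / s ^+ 2).
  have e1 : 1 < 1 + e / s ^+ 2 by rewrite ltrDl divr_gt0.
  have := upper u; rewrite /u sqr_sqrtr; last by rewrite ltW// (lt_trans _ e1).
  rewrite mulrDr mulr1 mulrCA divff ?gt_eqF// mulr1 EFinD; apply.
  by rewrite -[ltLHS]sqrtr1 ltr_sqrt// (lt_trans _ e1).
rewrite leNgt; apply/negP => Mlt.
have Mfin : M \is a fin_num.
  rewrite ge0_fin_numE ?(lt_trans Mlt) ?ltry//.
  by apply: integral_ge0 => x _; exact: M0.
have Mr : fine M < s ^+ 2 by rewrite -lte_fin fineK.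
have M0' : 0 <= fine M by rewrite fine_ge0// integral_ge0.
(* The lower bound fails for u the square root of v, the midpoint of M / s ^ 2
   and 1: it would give s ^ 2 v <= M. *)
pose v := (1 + fine M / s ^+ 2) / 2.
have Mv : fine M / s ^+ 2 < 1 by rewrite ltr_pdivrMr// mul1r.
have Mv0 : 0 <= fine M / s ^+ 2 by rewrite divr_ge0// ltW.
have v0 : 0 < v by rewrite /v; lra.
have v1 : v < 1 by rewrite /v; lra.
have vs : Num.sqrt v ^+ 2 = v by rewrite sqr_sqrtr// ltW.
have sv0 : 0 < Num.sqrt v by rewrite sqrtr_gt0.
have sv1 : Num.sqrt v < 1 by rewrite -[ltRHS]sqrtr1 ltr_sqrt.
have := lower _ sv0 sv1; rewrite vs -(fineK Mfin) lee_fin leNgt => /negP; apply.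
by rewrite -ltr_pdivrMl// mulrC /v; lra.
Qed.
End gaussian_law.

(** * Linear combinations of independent standard normal variables *)

Section gaussian_combinations.
Context d (W : measurableType d) (R : realType) (P : probability W R).
Variables (I : eqType) (gamma : I -> {RV P >-> R}).
Hypothesis hgamma : iid_standard_gaussian gamma.
Variable J : seq I.
Hypothesis uJ : uniq J.

Let Fam : set (set W) := [set setT].

Let FamT : Fam setT. Proof. by []. Qed.

Let mFam D : Fam D -> measurable D. Proof. by move=> ->. Qed.

Let indep (D : set W) (K : seq I) (B : I -> set R) :
  Fam D -> uniq K -> (forall k, measurable (B k)) ->
  P (D `&` \bigcap_(k in [set` K]) (gamma k @^-1` B k)) =
    (P D * \prod_(k <- K) P (gamma k @^-1` B k))%E.
Proof.
move=> -> uK mB; rewrite setTI probability_setT mul1e.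
have [_ hind] := hgamma; apply: hind => // i _.
by exists (B i) => //; rewrite setTI.
Qed.

Definition lincomb (c : I -> R) (s : seq I) (w : W) : R :=
  \sum_(i <- s) c i * gamma i w.

Let op (c : I -> R) (i : I) (s x : R) : R := s + c i * x.

Let mop c i : measurable_fun setT (fun z : R * R => op c i z.1 z.2).
Proof. by apply: measurable_funD => //; apply: measurable_funM. Qed.

Let foldE c s : fold_rv gamma (op c) 0 s = lincomb c s.
Proof.
apply/funext => w; elim: s => [|i s IH]; first by rewrite /lincomb big_nil.
by rewrite /lincomb big_cons addrC /= -[X in X + _]IH.
Qed.

Lemma measurable_lincomb c s : measurable_fun setT (lincomb c s).
Proof. by rewrite -foldE; exact: measurable_fold_rv. Qed.

(** The initial state 0 has as law the point mass, which is [gaussian_law 0];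
    each new variable adds the square of its coefficient to the variance. *)
Lemma lincomb_law c (s : seq I) : uniq s -> forall A, measurable A ->
  P (lincomb c s @^-1` A) = gaussian_law (Num.sqrt (\sum_(i <- s) c i ^+ 2)) A.
Proof.
elim: s => [_ A mA|i s IH /= /andP[is_ us] A mA].
  rewrite big_nil sqrtr0 /gaussian_law eqxx diracE.
  have [A0|A0] := pselect (A 0).
    rewrite mem_set// (_ : _ @^-1` _ = setT) ?probability_setT//.
    by apply/seteqP; split => // w _; rewrite /= /lincomb big_nil.
  rewrite memNset// (_ : _ @^-1` _ = set0) ?measure0//.
  by apply/seteqP; split => // w; rewrite /= /lincomb big_nil.
pose L := distribution P (HB.pack_for {mfun W >-> R} (lincomb c s)
  (isMeasurableFun.Build _ _ _ _ (lincomb c s) (measurable_lincomb c s))).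
pose N := distribution P (gamma i).
have [hlaw _] := hgamma.
have mC : measurable [set z : R * R | A (z.1 + c i * z.2)].
  by rewrite -[X in measurable X]setTI; exact: (mop c i).
rewrite -(@gaussian_law_step R L N (Num.sqrt (\sum_(i <- s) c i ^+ 2)) (c i))//.
- rewrite -[RHS]mul1e -(@pair_law _ _ _ _ _ _ _ P setT (lincomb c s) (gamma i) L N)//.
  + rewrite setTI; congr (P _); apply/seteqP.
    by split => w; rewrite /= /lincomb big_cons addrC.
  + exact: measurable_lincomb.
  + move=> B1 B2 mB1 mB2; rewrite setTI mul1e.
    have := @independent_fold _ _ _ _ _ _ _ P _ gamma Fam FamT mFam indep (op c) 0
      (mop c) s setT [:: i] B1 (fun=> B2) FamT _ mB1 (fun=> mB2).
    rewrite setTI probability_setT mul1e foldE big_seq1 set_cons1 bigcap_set1.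
    by apply; rewrite cat_uniq us /= orbF is_.
- by move=> B mB; exact: IH.
- by move=> B mB; exact: hlaw.
have sq s' : 0 <= \sum_(i <- s') c i ^+ 2 by apply: sumr_ge0 => k _; exact: sqr_ge0.
by rewrite !sqr_sqrtr// big_cons addrC.
Qed.

Let mX2 c : measurable_fun setT (fun w => lincomb c J w ^+ 2).
Proof. by apply: measurable_funX; exact: measurable_lincomb. Qed.

Lemma lincomb_second_moment c :
  (\int[P]_w (lincomb c J w ^+ 2)%:E = (\sum_(i <- J) c i ^+ 2)%:E)%E.
Proof.
pose L := distribution P (HB.pack_for {mfun W >-> R} (lincomb c J)
  (isMeasurableFun.Build _ _ _ _ (lincomb c J) (measurable_lincomb c J))).
have mx2 : measurable_fun [set: R] (fun x : R => (x ^+ 2)%:E).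
  by apply/measurable_EFinP; exact: measurable_funX.
have x20 x : (0 <= (x ^+ 2 : R)%:E)%E by rewrite lee_fin sqr_ge0.
have -> : (\int[P]_w (lincomb c J w ^+ 2)%:E = \int[L]_x (x ^+ 2)%:E)%E.
  by rewrite /L ge0_integral_distribution.
set v := \sum_(i <- J) _.
have v0 : 0 <= v by apply: sumr_ge0 => k _; exact: sqr_ge0.
have [sv0|sv0] := eqVneq (Num.sqrt v) 0.
  have -> : v = 0 by rewrite -(sqr_sqrtr v0) sv0 expr0n.
  transitivity (\int[\d_(0%R : R)]_x (x ^+ 2)%:E)%E.
    apply: eq_measure_integral => B mB _.
    by have := lincomb_law c uJ mB; rewrite -/v /gaussian_law sv0 eqxx.
  by rewrite integral_dirac// diracT mul1e expr0n.
rewrite (@ge0_integral_normal_law _ _ 0 (Num.sqrt v))//.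
  by rewrite gaussian_second_moment// sqr_sqrtr.
by move=> B mB; have := lincomb_law c uJ mB; rewrite -/v /gaussian_law (negbTE sv0).
Qed.

Lemma lincomb_sqr_integrable c :
  P.-integrable setT (EFin \o (fun w => lincomb c J w ^+ 2)).
Proof.
apply/integrableP; split; first exact/measurable_EFinP.
under eq_integral do rewrite /= ger0_norm ?sqr_ge0//.
by rewrite lincomb_second_moment ltry.
Qed.

Lemma lincomb_integrable c : P.-integrable setT (EFin \o lincomb c J).
Proof.
have i1 : P.-integrable setT (EFin \o (fun w => 1 + lincomb c J w ^+ 2)).
  apply: (@integrableD _ _ _ _ _ measurableT (EFin \o cst 1)
    (EFin \o (fun w => lincomb c J w ^+ 2))).
    by apply: (@bounded_integrable _ _ _ _ _ 1) => // w; rewrite normr1.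
  exact: lincomb_sqr_integrable.
apply: (le_integrable measurableT _ _ i1).
  by apply/measurable_EFinP; exact: measurable_lincomb.
move=> w _ /=; rewrite lee_fin [leRHS]ger0_norm ?addr_ge0 ?sqr_ge0//.
rewrite -[lincomb c J w ^+ 2]real_normK ?num_real//; set y := `|_|.
have := sqr_ge0 (y - 1 / 2); nra.
Qed.

(** Changing the sign of all the coefficients does not change the law, hence not
    the mean. *)
Lemma lincomb_mean c : \int[P]_w lincomb c J w = 0.
Proof.
have lcN : lincomb (fun i => - c i) J = fun w => - lincomb c J w.
  apply/funext => w; rewrite /lincomb -sumrN.
  by apply: eq_bigr => i _; rewrite mulNr.
pose X e : {mfun W >-> R} := HB.pack_for {mfun W >-> R} (lincomb e J)
  (isMeasurableFun.Build _ _ _ _ (lincomb e J) (measurable_lincomb e J)).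
have E e : (\int[P]_w (lincomb e J w)%:E =
    \int[distribution P (X e)]_x x%:E)%E.
  rewrite (@integral_distribution _ _ _ _ _ P (X e) EFin)//.
  exact: lincomb_integrable.
have h : \int[P]_w lincomb c J w = \int[P]_w (- lincomb c J w).
  rewrite -lcN /Rintegral !E; congr fine.
  apply: eq_measure_integral => B mB _.
  apply: (etrans (lincomb_law c uJ mB)).
  apply: (etrans _ (esym (lincomb_law (fun i => - c i) uJ mB))).
  by under [in RHS]eq_bigr do rewrite sqrrN.
have N : \int[P]_w (- lincomb c J w) = - (\int[P]_w lincomb c J w).
  rewrite -mulN1r -RintegralZl//; last exact: lincomb_integrable.
  by apply: eq_Rintegral => w _; rewrite mulN1r.
by move: h; rewrite N => h; lra.
Qed.

Lemma lincombM_integrable a b :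
  P.-integrable setT (EFin \o (fun w => lincomb a J w * lincomb b J w)).
Proof.
have i1 : P.-integrable setT
    (EFin \o (fun w => lincomb a J w ^+ 2 + lincomb b J w ^+ 2)).
  by apply: (@integrableD _ _ _ _ _ measurableT
    (EFin \o (fun w => lincomb a J w ^+ 2))
    (EFin \o (fun w => lincomb b J w ^+ 2))); exact: lincomb_sqr_integrable.
apply: (le_integrable measurableT _ _ i1).
  by apply/measurable_EFinP; apply: measurable_funM; exact: measurable_lincomb.
move=> w _ /=; rewrite lee_fin [leRHS]ger0_norm ?addr_ge0 ?sqr_ge0//.
rewrite ler_norml.
set x := lincomb a J w; set y := lincomb b J w.
by have := sqr_ge0 (x - y); have := sqr_ge0 (x + y); nra.
Qed.

(** Polarization: the sum of the two combinations is the combination with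
    coefficients a + b, so its second moment is known. *)
Lemma lincomb_covariance a b :
  \int[P]_w (lincomb a J w * lincomb b J w) = \sum_(i <- J) a i * b i.
Proof.
have R2 c : \int[P]_w (lincomb c J w ^+ 2) = \sum_(i <- J) c i ^+ 2.
  by rewrite /Rintegral lincomb_second_moment.
have lcD w : lincomb (fun i => a i + b i) J w = lincomb a J w + lincomb b J w.
  by rewrite /lincomb -big_split; apply: eq_bigr => i _; rewrite mulrDl.
have iX := lincomb_sqr_integrable; have iM := lincombM_integrable a b.
have i2 : P.-integrable setT
    (EFin \o (fun w => 2 * (lincomb a J w * lincomb b J w))).
  by rewrite /comp; under eq_fun do rewrite EFinM; exact: integrableZl.
have i12 : P.-integrable setT (EFin \o
    (fun w => lincomb a J w ^+ 2 + 2 * (lincomb a J w * lincomb b J w))).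
  exact: (integrableD measurableT (iX a) i2).
have := R2 (fun i => a i + b i).
have -> : \int[P]_w (lincomb (fun i => a i + b i) J w ^+ 2) =
    \int[P]_w (lincomb a J w ^+ 2 + 2 * (lincomb a J w * lincomb b J w)
      + lincomb b J w ^+ 2).
  by apply: eq_Rintegral => w _; rewrite lcD; ring.
rewrite (RintegralD measurableT i12 (iX b)) (RintegralD measurableT (iX a) i2).
rewrite (RintegralZl _ measurableT iM) !R2.
have -> : \sum_(i <- J) (a i + b i) ^+ 2 = \sum_(i <- J) a i ^+ 2 +
    2 * (\sum_(i <- J) a i * b i) + \sum_(i <- J) b i ^+ 2.
  rewrite mulr_sumr -!big_split; apply: eq_bigr => i _ /=; ring.
by lra.
Qed.

End gaussian_combinations.

Section complex_combinations.
Context d (W : measurableType d) (R : realType) (P : probability W R).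
Variables (I : finType) (gamma : I -> {RV P >-> R}).
Hypothesis hgamma : iid_standard_gaussian gamma.
Let J := index_enum I.
Let uJ : uniq J := index_enum_uniq I.
Implicit Types A B : I -> R[i].

Definition clincomb A (w : W) : R[i] := \sum_(i : I) A i * (gamma i w)%:C%C.

Lemma clincombE A w : clincomb A w =
  (lincomb gamma (fun i => complex.Re (A i)) J w +i*
   lincomb gamma (fun i => complex.Im (A i)) J w)%C.
Proof.
rewrite /clincomb /lincomb -/J; elim: J => [|i s IH]; first by rewrite !big_nil.
rewrite !big_cons IH; case: (A i) => a b.
by rewrite /GRing.mul /= !mulr0 subr0 add0r.
Qed.

Lemma clincomb_gaussian (X : Type) (A : X -> I -> R[i]) :
  complex_gaussian_field P (fun x => clincomb (A x)).
Proof.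
move=> n x a b.
(* A real combination of real and imaginary parts is again a real combination
   of the gamma_i. *)
pose c i := \sum_(k < n) (a k * complex.Re (A (x k) i) + b k * complex.Im (A (x k) i)).
have -> : (fun w => \sum_(k < n) (a k * complex.Re (clincomb (A (x k)) w) +
    b k * complex.Im (clincomb (A (x k)) w))) = lincomb gamma c J.
  apply/funext => w; rewrite /lincomb /c.
  under [RHS]eq_bigr do rewrite mulr_suml.
  rewrite exchange_big; apply: eq_bigr => k _; rewrite clincombE /=.
  rewrite /lincomb !mulr_sumr -big_split; apply: eq_bigr => i _ /=; ring.
split; first exact: measurable_lincomb.
by exists 0, (Num.sqrt (\sum_(i <- J) c i ^+ 2)) => B mB; exact: lincomb_law.
Qed.

Lemma clincomb_mean A : cexpectation P (clincomb A) = 0.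
Proof.
rewrite /cexpectation /cintegral.
under eq_Rintegral do rewrite clincombE /=.
under [X in (_ +i* X)%C]eq_Rintegral do rewrite clincombE /=.
by rewrite !lincomb_mean.
Qed.

Lemma clincomb_covariance A B :
  cexpectation P (fun w => clincomb A w * (clincomb B w)^*%C) =
  \sum_(i : I) A i * (B i)^*%C.
Proof.
pose a1 i := complex.Re (A i); pose a2 i := complex.Im (A i).
pose b1 i := complex.Re (B i); pose b2 i := complex.Im (B i).
have iM u v := lincombM_integrable hgamma uJ u v.
have -> : cexpectation P (fun w => clincomb A w * (clincomb B w)^*%C) =
    ((\sum_(i <- J) a1 i * b1 i + \sum_(i <- J) a2 i * b2 i) +i*
     (\sum_(i <- J) a2 i * b1 i - \sum_(i <- J) a1 i * b2 i))%C.
  rewrite -!(lincomb_covariance hgamma uJ).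
  congr (_ +i* _)%C.
    rewrite -(RintegralD measurableT (iM _ _) (iM _ _)).
    by apply: eq_Rintegral => w _; rewrite !clincombE /= mulrN opprK.
  rewrite -(RintegralB measurableT (iM _ _) (iM _ _)).
  by apply: eq_Rintegral => w _; rewrite !clincombE /= mulrN addrC.
rewrite -/J; elim: J => [|i s IH]; first by rewrite !big_nil addr0 subr0.
rewrite !big_cons -IH /a1 /a2 /b1 /b2; case: (A i) => x1 x2; case: (B i) => y1 y2.
rewrite /= [RHS]/GRing.add [X in _ = ComplexField.addc X _]/GRing.mul /=.
by congr (_ +i* _)%C; ring.
Qed.

End complex_combinations.

(** * Coefficients of the field *)

Section krawtchouk_field.
Variables (R : realType) (q : nat).

(** The coefficient of index 0 is multiplicative, and that of each factor is 1. *)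
Lemma krawtchouk_zero (m : 'I_q -> nat) (l : multinom q.-1) :
  (forall k, l k = 0%N) -> krawtchouk R m l = 1.
Proof.
move=> l0; have -> : l = mnm0 by apply/mnmP => k; rewrite l0 mnm0E.
rewrite /krawtchouk rmorph_prod big1// => j _; rewrite rmorphXn /=.
rewrite mcoeffD mcoeff1 eqxx raddf_sum big1 ?addr0 ?expr1n// => k _.
rewrite /= mcoeffZ mcoeffX.
have -> : (mnm1 k == mnm0) = false.
  by apply/eqP => /mnmP/(_ k); rewrite mnm1E mnm0E eqxx.
by rewrite mulr0.
Qed.

Lemma h_zero d (l : multinom q.-1) : (forall k, l k = 0%N) -> h R d l = 1.
Proof.
move=> l0; have -> : l = mnm0 by apply/mnmP => k; rewrite l0 mnm0E.
rewrite /h mdeg0 subn0 big1 ?mulr1; last by move=> k _; rewrite mnm0E fact0.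
by rewrite divff ?invr1// pnatr_eq0 -lt0n fact_gt0.
Qed.

Lemma h_gt0 d (l : multinom q.-1) : 0 < h R d l.
Proof.
have f0 n : 0 < n`!%:R :> R by rewrite ltr0n fact_gt0.
by rewrite invr_gt0 divr_gt0// mulr_gt0// prodr_gt0.
Qed.

Variables (mu : probability (q.-tuple R) R) (hmu : mu (distributions R q) = 1%E).

Lemma measurable_monomial n : measurable_fun (closed_disc R) (fun z => z ^+ n).
Proof.
apply: measurable_funTS.
by apply: measurable_fun_complexX; exact: measurable_id.
Qed.

Lemma monomial_disc n : {homo (fun z : R[i] => z ^+ n) : z / closed_disc R z}.
Proof. by move=> z z1; rewrite /closed_disc /= normrX exprn_ile1. Qed.

Lemma kappa_le1 l : `|kappa mu l| <= 1.
Proof.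
apply: (cintegral_prod_disc_le1 (nu_polydisc hmu) (f := fun k z => z ^+ l k)).
- by move=> k; exact: measurable_monomial.
- by move=> k; exact: monomial_disc.
Qed.

(** Real of modulus at most 1, kappa is at most 1. *)
Lemma kappa_denominator (alpha : R) l : 0 < alpha -> alpha < 1 ->
  kappa mu l \is Num.real ->
  exists2 D : R, 0 < D &
    1 + (alpha / (1 - alpha))%:C%C * (1 - kappa mu l) = D%:C%C.
Proof.
move=> a0 a1 /complex_realP[k kE]; have := kappa_le1 l; rewrite kE => k1.
have {}k1 : k <= 1.
  by have := normc_Re_le (e := 1) k1; rewrite /= ler_norml => /andP[].
exists (1 + alpha / (1 - alpha) * (1 - k)).
  by rewrite ltr_pwDl// mulr_ge0 ?divr_ge0 ?subr_ge0// ltW.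
by rewrite [RHS]rmorphD [X in _ = _ + X]rmorphM [X in _ = _ + _ * X]rmorphB rmorph1.
Qed.

End krawtchouk_field.

Section product_moments.
Context dO (O : measurableType dO) (R : realType) (P : probability O R).
Variables (q : nat) (alpha : R) (alpha0 : 0 < alpha) (alpha1 : alpha < 1).
Variables (mu : probability (q.-tuple R) R) (hmu : mu (distributions R q) = 1%E).
Variables (T : {RV P >-> nat}) (xi : nat -> {RV P >-> q.-1.-tuple R[i]}).
Hypothesis hxi : is_point_process alpha (1 / 2) (nu mu) T xi.

(** The generating functional at f_k(z) = z ^ l_k. *)
Lemma point_product_moment (l : multinom q.-1) :
  cexpectation P (fun w => \prod_(k < q.-1) point_product T xi k w ^+ l k) =
  (sqrtc (1 + (alpha / (1 - alpha))%:C%C * (1 - kappa mu l)))^-1.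
Proof.
pose f (k : 'I_q.-1) (z : R[i]) := z ^+ l k.
have mf k : measurable_fun (closed_disc R) (f k) by exact: measurable_monomial.
have fd k : {homo f k : z / closed_disc R z} by exact: monomial_disc.
have -> : kappa mu l = cintegral (nu mu) (fun z => \prod_(k < q.-1) f k (tnth z k)).
  by [].
rewrite -(cintegral_one_sub_prod_disc (nu_polydisc hmu) mf fd).
rewrite -(generating_functional alpha0 alpha1 (nu_polydisc hmu) hxi mf fd).
congr cexpectation; apply/funext => w; rewrite exchange_big /=.
by apply: eq_bigr => k _; rewrite /point_product prodrXl.
Qed.

End product_moments.

(** * The Gaussian field and its two representations *)

Theorem proposition9 (R : realType) (q d : nat)
  (hq : (2 <= q)%N) (hd : (1 <= d)%N)
  (alpha : R) (halpha0 : 0 < alpha) (halpha1 : alpha < 1)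
  (mu : probability (q.-tuple R) R)
  (hmu : mu (distributions R q) = 1%E)
  (hkappa : forall l : bmultinom q.-1 d.+1, kappa mu l \is Num.real)
  (dW : measure_display) (W : measurableType dW) (PW : probability W R)
  (gamma : bmultinom q.-1 d.+1 -> {RV PW >-> R})
  (hgamma : iid_standard_gaussian gamma)
  (dO : measure_display) (O : measurableType dO) (P : probability O R)
  (T : {RV P >-> nat}) (xi : nat -> {RV P >-> q.-1.-tuple R[i]})
  (hxi : is_point_process alpha (1 / 2) (nu mu) T xi) :
  let g := gfield alpha mu gamma in
  let Y := point_product T xi in
  let EY (l : bmultinom q.-1 d.+1) :=
    cexpectation P (fun w => \prod_(k < q.-1) Y k w ^+ l k) in
  [/\ complex_gaussian_field PW g /\
        (forall x, cexpectation PW (g x) = 0),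
      forall x y : {ffun 'I_d -> 'I_q},
        ccovariance PW (g x) (g y)
          = cexpectation PW (fun w => g x w * (g y w)^*%C)
        /\
        cexpectation PW (fun w => g x w * (g y w)^*%C)
          = ((q%:R ^+ d)^-1)%:C%C *
            \sum_(l : bmultinom q.-1 d.+1)
              (h R d l)%:C%C /
                (1 + (alpha / (1 - alpha))%:C%C * (1 - kappa mu l))
              * krawtchouk R (type_of x) l
              * (krawtchouk R (type_of y) l)^*%C,
      forall (x : {ffun 'I_d -> 'I_q}) (w : W),
        g x w = ((q%:R `^ (d%:R / 2))^-1)%:C%C *
          \sum_(l : bmultinom q.-1 d.+1)
            EY l * sqrtc (h R d l)%:C%C * krawtchouk R (type_of x) l
            * (gamma l w)%:C%C,
      forall (x : {ffun 'I_d -> 'I_q}) (w : W) (l0 : bmultinom q.-1 d.+1),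
        (forall k, l0 k = 0%N) ->
        EY l0 * sqrtc (h R d l0)%:C%C * krawtchouk R (type_of x) l0
          * (gamma l0 w)%:C%C = (gamma l0 w)%:C%C
    & forall f : 'I_q.-1 -> R[i] -> R[i],
        (forall k, measurable_fun (closed_disc R) (f k)) ->
        (forall k, {homo f k : z / closed_disc R z}) ->
        cexpectation P (fun w =>
            \prod_(b < T w) \prod_(k < q.-1) f k (tnth (xi b w) k))
          = (sqrtc (1 + (alpha / (1 - alpha))%:C%C *
               cintegral (nu mu)
                 (fun z => 1 - \prod_(k < q.-1) f k (tnth z k))))^-1].
Proof.
move=> g Y EY.
have D_ l := kappa_denominator hmu halpha0 halpha1 (hkappa l).
pose s : R := (q%:R `^ (d%:R / 2))^-1.
have s2 : s * s = (q%:R ^+ d)^-1.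
  rewrite /s -invfM -powRD; last by rewrite pnatr_eq0 -lt0n (leq_trans _ hq) ?implybT.
  by rewrite -splitr powR_mulrn.
pose coef (l : bmultinom q.-1 d.+1) : R[i] := sqrtc ((h R d l)%:C%C /
  (1 + (alpha / (1 - alpha))%:C%C * (1 - kappa mu l))).
pose A (x : {ffun 'I_d -> 'I_q}) (l : bmultinom q.-1 d.+1) : R[i] :=
  s%:C%C * (coef l * krawtchouk R (type_of x) l).
have gE x : g x = clincomb gamma (A x).
  apply/funext => w; rewrite /g /gfield /clincomb mulr_sumr.
  by apply: eq_bigr => l _; rewrite /A !mulrA.
have coefE (l : bmultinom q.-1 d.+1) : exists2 D : R, 0 < D &
    [/\ 1 + (alpha / (1 - alpha))%:C%C * (1 - kappa mu l) = D%:C%C,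
        coef l = (Num.sqrt (h R d l / D))%:C%C &
        coef l = EY l * sqrtc (h R d l)%:C%C].
  have [D D0 DE] := D_ l; exists D => //.
  have hD : 0 <= h R d l / D by rewrite divr_ge0 ?ltW ?h_gt0.
  have cE : coef l = (Num.sqrt (h R d l / D))%:C%C.
    rewrite /coef DE -fmorphV -rmorphM sqrtc_sqrtr//.
    by rewrite ler0c.
  split=> //; rewrite cE /EY (point_product_moment halpha0 halpha1 hmu hxi) DE.
  rewrite !sqrtc_sqrtr ?ler0c ?ltW ?h_gt0// -fmorphV -rmorphM /=; congr (_%:C%C).
  have h0 := ltW (h_gt0 R d l).
  by rewrite sqrtrM// (sqrtrV (ltW D0)) mulrC.
have mean0 x : cexpectation PW (g x) = 0 by rewrite gE clincomb_mean.
split.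
- split=> //; have -> : g = fun x => clincomb gamma (A x) by apply/funext => x.
  exact: clincomb_gaussian.
- move=> x y; split.
    rewrite /ccovariance !mean0; congr cexpectation; apply/funext => w.
    by rewrite !subr0.
  rewrite !gE clincomb_covariance// mulr_sumr; apply: eq_bigr => l _.
  have [D D0 [DE cE _]] := coefE l.
  have cc : coef l * (coef l)^*%C = (h R d l)%:C%C / D%:C%C.
    have hD : 0 <= h R d l / D by rewrite divr_ge0// ltW// h_gt0.
    rewrite cE conjc_real -rmorphM -expr2 (sqr_sqrtr hD) rmorphM.
    by rewrite [X in _ * X = _]fmorphV.
  have cA (u v : R[i]) : (s%:C%C * (u * v))^*%C = s%:C%C * (u^*%C * v^*%C).
    by rewrite !rmorphM; congr (_ * _); exact: conjc_real.
  rewrite /A cA DE -cc -s2 rmorphM.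
  by ring.
- move=> x w; rewrite /g /gfield; congr (_ * _); apply: eq_bigr => l _.
  by have [D D0 [_ _ <-]] := coefE l.
- move=> x w l0 l00.
  have -> : EY l0 = 1.
    rewrite /EY -[RHS](cintegral_cst P); congr cexpectation; apply/funext => v.
    by rewrite big1// => k _; rewrite l00 expr0.
  by rewrite h_zero// krawtchouk_zero// sqrtc1 !mul1r.
- move=> f mf fd; exact: (generating_functional halpha0 halpha1 (nu_polydisc hmu) hxi).
Qed.
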